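(* Let $n\ge 3$, let $P$ be a compact Coxeter polytope in $\mathbb{H}^n$, let $O$ be an interior point of $P$, and let $E$ be an outermost edge of $P$ relative to $O$. If the ridge associated with $E$ is right-angled, then its width $\mathbf{t}(n)$ satisfies $\mathbf{t}(n)<\frac{n+1}{n-1}$. In particular, every compact right-angled Coxeter polytope in $\mathbb{H}^n$ has a ridge of width less than $\frac{n+1}{n-1}$.
   Context: A Coxeter polytope in hyperbolic space $\mathbb{H}^n$ (metric $\rho$) is a convex polytope all of whose dihedral angles are of the form $\pi/k$, $k\ge2$ an integer; it is right-angled if all its dihedral angles equal $\pi/2$. Facets are faces of codimension 1. For an edge $E$, let $F_1,\dots,F_{n-1}$ be the facets containing $E$ and $F_n,F_{n+1}$ the framing facets of $E$ (the facets containing a vertex of $E$ but not $E$). The ridge associated with $E$ is $\{F_1,\dots,F_{n+1}\}$; its width is $\cosh\rho(F_n,F_{n+1})$. The ridge is right-angled if the dihedral angle between $F_i$ and $F_j$ equals $\pi/2$ for all pairs $1\le i<j\le n+1$ with $\{i,j\}\neq\{n,n+1\}$. An edge $E$ is outermost relative to $O$ if $\rho(O,E)=\max_{E'}\rho(O,E')$ over all edges $E'$ of $P$. *)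

(* Defs.v *)
From HB Require Import structures.
From mathcomp Require Import all_boot all_order all_algebra.
From mathcomp Require Import all_classical all_reals all_analysis.
Set Implicit Arguments. Unset Strict Implicit. Unset Printing Implicit Defensive.
Import Order.TTheory GRing.Theory Num.Theory.
Local Open Scope ring_scope.
Local Open Scope classical_set_scope.

Section Hyperbolic.
Variables (R : realType) (n : nat).

(* Points / vectors of the Minkowski space R^{1,n}; coordinate 0 is time-like. *)
Notation vec := 'rV[R]_(n.+1).

Definition lor (x y : vec) : R :=
  - (x ord0 ord0 * y ord0 ord0) + \sum_(i < n.+1 | i != ord0) x ord0 i * y ord0 i.

(* Hyperboloid model of H^n. *)
Definition hyp : set vec := [set x | lor x x = -1 /\ 0 < x ord0 ord0].

(* cosh of the hyperbolic distance between two points of H^n. *)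
Definition coshd (x y : vec) : R := - lor x y.

(* cosh of the distance from a point to a set (cosh is increasing, so
   cosh (inf rho) = inf (cosh rho)). *)
Definition coshdist_pt (O : vec) (A : set vec) : R := inf [set coshd O x | x in A].

Definition coshdist (A B : set vec) : R := inf [set coshd x y | x in A & y in B].

Definition span_indep (A : set vec) (k : nat) : Prop :=
  exists f : 'I_k -> vec, (forall i, A (f i)) /\ row_free (\matrix_(i < k) f i).

(* The linear span of A has dimension exactly k
   (i.e. A is a subset of H^n of hyperbolic dimension k-1). *)
Definition spandim (A : set vec) (k : nat) : Prop :=
  span_indep A k /\ ~ span_indep A k.+1.

Variables (m : nat) (e : 'I_m -> vec).

(* The polytope P = { x in H^n | <x, e_i> <= 0 for all i }, e_i outward unit normals. *)
Definition polytope : set vec := [set x | hyp x /\ forall i, lor x (e i) <= 0].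

Definition facet (i : 'I_m) : set vec := [set x | polytope x /\ lor x (e i) = 0].

Definition face (S : {set 'I_m}) : set vec :=
  [set x | polytope x /\ forall i, i \in S -> lor x (e i) = 0].

Definition is_edge (E : set vec) : Prop := exists S, E = face S /\ spandim E 2.
Definition is_vertex (v : vec) : Prop := exists S, face S = [set v].

Definition adjacent (i j : 'I_m) : Prop :=
  i != j /\ spandim (facet i `&` facet j) n.-1.

(* interior dihedral angle between adjacent facets (outward unit normals) *)
Definition dihedral (i j : 'I_m) : R := acos (- lor (e i) (e j)).

(* P is a compact convex polytope of H^n given by an irredundant family of
   half-spaces: unit space-like normals, distinct, nonempty interior,
   bounded, and every half-space contributes a facet (codimension 1). *)
Definition compact_polytope : Prop :=
  [/\ forall i, lor (e i) (e i) = 1,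
      injective e,
      exists x, hyp x /\ forall i, lor x (e i) < 0,
      exists C : R, forall x, polytope x -> x ord0 ord0 <= C
    & forall i, spandim (facet i) n].

Definition coxeter : Prop :=
  forall i j, adjacent i j -> exists k : nat, (2 <= k)%N /\ dihedral i j = pi / k%:R.

Definition right_angled : Prop :=
  forall i j, adjacent i j -> dihedral i j = pi / 2.

Definition interior_point (O : vec) : Prop := hyp O /\ forall i, lor O (e i) < 0.

Definition outermost (O : vec) (E : set vec) : Prop :=
  is_edge E /\ forall E', is_edge E' -> coshdist_pt O E' <= coshdist_pt O E.

Definition contains (E : set vec) (i : 'I_m) : Prop := E `<=` facet i.

Definition framing (E : set vec) (i : 'I_m) : Prop :=
  (exists v, [/\ is_vertex v, E v & facet i v]) /\ ~ contains E i.

Definition in_ridge (E : set vec) (i : 'I_m) : Prop := contains E i \/ framing E i.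

Definition right_angled_ridge (E : set vec) : Prop :=
  forall i j, i != j -> in_ridge E i -> in_ridge E j ->
    ~ (framing E i /\ framing E j) -> dihedral i j = pi / 2.

Definition width (i j : 'I_m) : R := coshdist (facet i) (facet j).

End Hyperbolic.

(* Main.v *)
Require Import Defs.
From HB Require Import structures.
From mathcomp Require Import all_boot all_order all_algebra.
From mathcomp Require Import all_classical all_reals all_analysis.
From mathcomp Require Import ring lra.
Import Order.TTheory GRing.Theory Num.Theory.
Set Implicit Arguments.
Unset Strict Implicit.
Unset Printing Implicit Defensive.
Local Open Scope ring_scope.
Local Open Scope classical_set_scope.

(** Let [T] be the set of facets containing the edge [E], [c_k = lor O (e k)], and
    [v], [w] the end points of [E], on the framing facets [i] and [j]. Since the
    ridge is right-angled, the projection [p = O - sum_(k in T) c_k e_k] of [O] to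
    the line of [E] lies on the inner side of both framing facets, so it is a
    positive combination [a v + b w]; hence the distance from [O] to [E] is the
    distance to the whole line, with [cosh^2 = 1 + sum_T c_k^2]. Replacing some
    [k] in [T] by [i] gives another edge at [v], at distance at least that of its
    line, for which [cosh^2 = 1 + sum_T c_l^2 - c_k^2 + c_i^2]; as [E] is outermost,
    [c_i^2 <= c_k^2], and likewise for [j]. With [t = coshd v w] one has
    [1 + sum_T c_k^2 = a^2 + b^2 + 2abt], [c_i^2 = b^2 (t^2 - 1)],
    [c_j^2 = a^2 (t^2 - 1)] and [#|T| >= n - 1], which forces [(n - 1) (t - 1) < 2].

    For a right-angled polytope, nonadjacent facets have normals with nonpositive
    product: otherwise projecting a point of one facet to the hyperplane of the
    other leaves the polytope without crossing any neighbour of the latter. The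
    normals at a point are then linearly independent, so any two facets with a
    common point are adjacent, hence orthogonal, and every ridge is right-angled. *)

(** * Minkowski space *)

Section Lorentz.
Variables (R : realType) (n : nat).
Notation vec := 'rV[R]_(n.+1).
Implicit Types (x y z u v w : vec) (a b c : R).

Lemma lorC x y : lor x y = lor y x.
Proof.
by rewrite /lor mulrC; congr (_ + _); apply: eq_bigr => i _; rewrite mulrC.
Qed.

Lemma lorDl x y z : lor (x + y) z = lor x z + lor y z.
Proof.
rewrite /lor !mxE mulrDl opprD -!addrA; congr (_ + _).
rewrite addrCA; congr (_ + _); rewrite -big_split /=.
by apply: eq_bigr => i _; rewrite mxE mulrDl.
Qed.

Lemma lorZl a x y : lor (a *: x) y = a * lor x y.
Proof.
rewrite /lor !mxE mulrDr mulrN mulrA; congr (_ + _); rewrite big_distrr /=.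
by apply: eq_bigr => i _; rewrite mxE mulrA.
Qed.

Lemma lorDr x y z : lor z (x + y) = lor z x + lor z y.
Proof. by rewrite ![lor z _]lorC lorDl. Qed.

Lemma lorZr a x y : lor y (a *: x) = a * lor y x.
Proof. by rewrite ![lor y _]lorC lorZl. Qed.

Lemma lorNl x y : lor (- x) y = - lor x y.
Proof. by rewrite -scaleN1r lorZl mulN1r. Qed.

Lemma lorNr x y : lor y (- x) = - lor y x.
Proof. by rewrite -scaleN1r lorZr mulN1r. Qed.

Lemma lor0l y : lor 0 y = 0.
Proof. by rewrite -(scale0r y) lorZl mul0r. Qed.

Lemma lor0r y : lor y 0 = 0.
Proof. by rewrite lorC lor0l. Qed.

Definition lor_bilin := (lorDl, lorDr, lorNl, lorNr, lorZl, lorZr, lor0l, lor0r).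

Lemma lor_suml (I : finType) (P : pred I) (F : I -> vec) y :
  lor (\sum_(i | P i) F i) y = \sum_(i | P i) lor (F i) y.
Proof.
exact: (big_morph (fun x => lor x y) (fun u v => lorDl u v y) (lor0l y)).
Qed.

Definition future x := lor x x < 0 /\ 0 < x ord0 ord0.

Lemma hyp_future x : hyp x -> future x.
Proof. by case=> h1 h2; split=> //; rewrite h1 oppr_lt0. Qed.

Lemma sqr_sum_pos (P : pred 'I_n.+1) (f : 'I_n.+1 -> R) :
  0 <= \sum_(i < n.+1 | P i) f i ^+ 2.
Proof. by apply: sumr_ge0 => i _; exact: sqr_ge0. Qed.

Let sp x y := \sum_(i < n.+1 | i != ord0) x ord0 i * y ord0 i.

Let sp_sqr a b x y : \sum_(i < n.+1 | i != ord0)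
    (a * x ord0 i - b * y ord0 i) ^+ 2
  = a ^+ 2 * sp x x - 2 * a * b * sp x y + b ^+ 2 * sp y y.
Proof.
rewrite /sp !big_distrr /= -sumrB -big_split /=.
by apply: eq_bigr => i _; ring.
Qed.

(** Multiplied by [x0' ^+ 2], the square norm of [y] becomes [y0 ^+ 2] plus the sum of squares of
    the spatial entries of [x0' * y - y0 * x]. *)
Lemma lor_perp x y : hyp x -> lor y x = 0 -> 0 <= lor y y ?= iff (y == 0).
Proof.
case=> hx x0; rewrite /lor => hyx.
set y0 := y ord0 ord0 in hyx *; set x0' := x ord0 ord0 in x0 hyx hx.
have H := sp_sqr x0' y0 y x.
have Hge := sqr_sum_pos (fun i => i != ord0)
  (fun i => x0' * y ord0 i - y0 * x ord0 i).
have {hyx} hyx : sp y x = y0 * x0' by apply/eqP; rewrite -subr_eq0 addrC hyx.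
have {}hx : sp x x = x0' ^+ 2 - 1 by move: hx; rewrite /lor /sp -/x0'; lra.
rewrite H hyx hx -/(sp y y) in Hge *.
have E : x0' ^+ 2 * (- (y0 * y0) + sp y y) =
  y0 ^+ 2 + (x0' ^+ 2 * sp y y - 2 * x0' * y0 * (y0 * x0') + y0 ^+ 2 * (x0' ^+ 2 - 1)).
  by ring.
have x02 : 0 < x0' ^+ 2 by rewrite exprn_gt0.
have ge0 : 0 <= - (y0 * y0) + sp y y.
  by rewrite -(pmulr_rge0 _ x02) E addr_ge0 ?sqr_ge0.
split=> //; apply/eqP/eqP => [h|h]; last first.
  by rewrite /y0 h /sp mxE mulr0 oppr0 add0r big1 // => i _; rewrite mxE mulr0.
move: E; rewrite -h mulr0 => E.
have y00 : y0 = 0.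
  by apply/eqP; rewrite -sqrf_eq0 eq_le sqr_ge0 andbT; lra.
have spy : sp y y = 0 by move: h; rewrite y00; lra.
apply/rowP => i; rewrite mxE; have [->//|i0] := eqVneq i ord0.
have := spy => /eqP; rewrite /sp psumr_eq0; last first.
  by move=> j _; rewrite -expr2 sqr_ge0.
by move/allP/(_ i (mem_index_enum i)); rewrite i0 /= mulf_eq0 orbb => /eqP.
Qed.

Lemma futureZ a x : 0 < a -> future x -> future (a *: x).
Proof.
move=> a0 [h1 h2]; split; last by rewrite mxE mulr_gt0.
by rewrite !lor_bilin mulrA pmulr_rlt0 // mulr_gt0.
Qed.

(** Cauchy-Schwarz for the spatial parts, in the weighted form [Hge]; the sign is read off after
    multiplying by the positive [a * b]. *)
Lemma lor_future_lt0 x y : future x -> future y -> lor x y < 0.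
Proof.
case=> hx x0 [hy y0].
have H := sp_sqr (y ord0 ord0) (x ord0 ord0) x y.
have Hge := sqr_sum_pos (fun i => i != ord0)
  (fun i => y ord0 ord0 * x ord0 i - x ord0 ord0 * y ord0 i).
rewrite {}H in Hge; move: hx hy; rewrite /lor -!/(sp _ _).
set a := x ord0 ord0 in x0 Hge *; set b := y ord0 ord0 in y0 Hge *.
move=> hx hy.
have ab : 0 < a * b by rewrite mulr_gt0.
have h1 : b ^+ 2 * sp x x < b ^+ 2 * (a * a).
  by rewrite ltr_pM2l ?exprn_gt0 //; lra.
have h2 : a ^+ 2 * sp y y < a ^+ 2 * (b * b).
  by rewrite ltr_pM2l ?exprn_gt0 //; lra.
rewrite -(pmulr_rlt0 _ ab).
set S := sp x y in Hge *; set X := sp x x in Hge h1 *; set Y := sp y y in Hge h2 *.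
have -> : a * b * (- (a * b) + S) = - (a ^+ 2 * b ^+ 2) + a * b * S by ring.
have e1 : b ^+ 2 * (a * a) = a ^+ 2 * b ^+ 2 by ring.
have e2 : a ^+ 2 * (b * b) = a ^+ 2 * b ^+ 2 by ring.
have e3 : 2 * b * a * S = 2 * (a * b * S) by ring.
rewrite e1 in h1; rewrite e2 in h2; rewrite e3 in Hge; lra.
Qed.

(** With a nonpositive time coordinate, [- z] would be future and [lor z x] would have the wrong
    sign. *)
Lemma future_of_lor x z : future x -> lor z z < 0 -> lor z x < 0 -> future z.
Proof.
move=> fx zz zx; split=> //; rewrite ltNge; apply/negP => z0.
have z0' : 0 < (- z) ord0 ord0.
  rewrite mxE oppr_gt0 lt_neqAle z0 andbT; apply: contraTneq zz => z00.
  rewrite -leNgt /lor z00 mul0r oppr0 add0r sumr_ge0 // => i _.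
  by rewrite -expr2 sqr_ge0.
have := @lor_future_lt0 (- z) x; rewrite lorNl oppr_lt0 => h.
suff /h/(_ fx) : future (- z) by lra.
by split=> //; rewrite lorNl lorNr opprK.
Qed.

Lemma futureD x y : future x -> future y -> future (x + y).
Proof.
move=> fx fy; have h := lor_future_lt0 fx fy; have [hx x0] := fx.
have [hy y0] := fy; split; last by rewrite mxE addr_gt0.
by rewrite !lor_bilin (lorC y x); lra.
Qed.

Definition normalize x := (Num.sqrt (- lor x x))^-1 *: x.

Lemma normalize_gt0 x : future x -> 0 < (Num.sqrt (- lor x x))^-1.
Proof. by case=> hx _; rewrite invr_gt0 sqrtr_gt0 oppr_gt0. Qed.

Lemma hyp_normalize x : future x -> hyp (normalize x).
Proof.
move=> fx; have a0 := normalize_gt0 fx; have [_ h2] := futureZ a0 fx.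
split=> //; rewrite /normalize !lor_bilin mulrA -invfM -expr2.
have [hx _] := fx; rewrite sqr_sqrtr ?oppr_ge0 ?(ltW hx) // mulrC.
by rewrite invrN mulrN mulfV // lt_eqF.
Qed.

(** The expression is the square norm of the component of [q] orthogonal to [x], to which [lor_perp]
    applies. *)
Lemma reversed_cauchy x q : hyp x -> 0 <= lor q q + lor q x ^+ 2 ?= iff (q == - lor q x *: x).
Proof.
move=> hx; have [xx _] := hx; rewrite -subr_eq0 scaleNr opprK.
have -> : lor q q + lor q x ^+ 2 = lor (q + lor q x *: x) (q + lor q x *: x).
  by rewrite !lor_bilin (lorC x q) xx; ring.
by apply: (lor_perp hx); rewrite !lor_bilin xx; ring.
Qed.

Lemma coshd_ge1 x y : hyp x -> hyp y -> 1 <= coshd x y ?= iff (x == y).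
Proof.
move=> hx hy; rewrite /coshd.
have xy := lor_future_lt0 (hyp_future hx) (hyp_future hy).
have [yy _] := hy; have [xx x0] := hx.
have [ge0 eq0] := reversed_cauchy x hy; rewrite xx in ge0 eq0.
split.
  by rewrite -ler_sqr ?nnegrE ?oppr_ge0 ?(ltW xy) // expr1n sqrrN; lra.
apply/eqP/eqP => [h|<-]; last by rewrite xx opprK.
have -> : x = - lor x y *: y by apply/eqP; rewrite -eq0 -[lor x y]opprK -h; apply/eqP; ring.
by rewrite -h scale1r.
Qed.

Lemma coshd_gt1 x y : hyp x -> hyp y -> x != y -> 1 < coshd x y.
Proof. by move=> hx hy; rewrite (lt_leif (coshd_ge1 hx hy)). Qed.

Lemma lor_nondeg x : (forall y, lor x y = 0) -> x = 0.
Proof.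
move=> h; apply/rowP => i; rewrite mxE.
have := h (delta_mx ord0 i); rewrite /lor.
have [->|i0] := eqVneq i ord0.
  rewrite big1 => [|j j0]; last by rewrite mxE (negbTE j0) andbF mulr0.
  by rewrite addr0 mxE !eqxx mulr1 => /eqP; rewrite oppr_eq0 => /eqP.
rewrite (bigD1 i) //= big1 => [|j /andP[_ ji]]; last first.
  by rewrite mxE (negbTE ji) andbF mulr0.
by rewrite !mxE !eqxx eq_sym (negbTE i0) !mulr0 oppr0 add0r addr0 mulr1.
Qed.

End Lorentz.

(** * Finite systems of inequalities along a segment or a ray *)

Lemma first_exit (R : realFieldType) (I : finType) (P : pred I) (a b : I -> R) :
    (forall l, P l -> a l < 0) -> (exists2 l, P l & 0 < b l) ->
  exists s, [/\ 0 < s, s < 1, forall l, P l -> (1 - s) * a l + s * b l <= 0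
              & exists2 l, P l & (1 - s) * a l + s * b l = 0].
Proof.
move=> ha [l0 Pl0 bl0].
have Q0 : (P l0 && (0 < b l0)) by rewrite Pl0.
(* The quotient is the parameter at which the affine function from [a l] to [b l] vanishes; its
   least value over the positive [b l] is the exit time. *)
case: (@arg_minP _ _ _ l0 (fun l => P l && (0 < b l)) (fun l => - a l / (b l - a l)) Q0).
move=> l /andP[Pl bl] hmin; have al := ha l Pl.
set s := _ / _ in hmin *.
have d0 : 0 < b l - a l by lra.
have es : s * (b l - a l) = - a l by rewrite /s divfK // gt_eqF.
exists s; split.
- by rewrite /s divr_gt0 // oppr_gt0.
- by rewrite /s ltr_pdivrMr // mul1r; lra.
- move=> k Pk; have ak := ha k Pk; have [bk|bk] := lerP (b k) 0.
    have s0 : 0 < s by rewrite /s divr_gt0 // oppr_gt0.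
    have s1 : s < 1 by rewrite /s ltr_pdivrMr // mul1r; lra.
    have h1 : 0 <= (1 - s) * - a k by rewrite mulr_ge0; lra.
    have h2 : 0 <= s * - b k by rewrite mulr_ge0; lra.
    lra.
  have := hmin k; rewrite Pk bk => /(_ isT); rewrite ler_pdivlMr; last by lra.
  lra.
- by exists l => //; lra.
Qed.

Lemma perturb_lt0 (R : realFieldType) (I : finType) (a b : I -> R) :
  exists2 r, 0 < r & forall l t, a l < 0 -> 0 < t <= r -> a l + t * b l < 0.
Proof.
suff [r r0 H] : exists2 r : R, 0 < r & forall l t, l \in enum I ->
    a l < 0 -> 0 < t <= r -> a l + t * b l < 0.
  by exists r => // l t; apply: H; rewrite mem_enum.
elim: (enum I) => [|k s [r r0 IH]]; first by exists 1.
have [ak|ak] := ltrP (a k) 0; last first.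
  by exists r => // l t; rewrite inE => /predU1P[-> akn|ls]; [lra|exact: IH].
pose q := - a k / (`|b k| - a k + 1).
have nb := normr_ge0 (b k).
have d0 : 0 < `|b k| - a k + 1 by lra.
have q0 : 0 < q by rewrite divr_gt0 //; lra.
exists (Num.min r q); first by rewrite lt_min r0.
move=> l t; rewrite le_min inE => /predU1P[->|ls] al /and3P[t0 tr tq]; last first.
  by apply: IH => //; rewrite t0.
have h : t * (`|b k| - a k + 1) <= - a k by rewrite -ler_pdivlMr.
have h2 : t * b k <= t * `|b k| by rewrite ler_pM2l // ler_norm.
have h3 : 0 < t * (1 - a k) by rewrite mulr_gt0 //; lra.
lra.
Qed.

(** * Independent families, spans and Lorentz-orthogonal complements *)

Section Span.
Variables (R : realType) (n : nat).
Notation vec := 'rV[R]_(n.+1).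

Lemma row_free_extend k (f : 'I_k -> vec) (a : vec) :
    row_free (\matrix_i f i) -> ~~ (a <= \matrix_i f i)%MS ->
  row_free (\matrix_i (if unlift (ord0 : 'I_k.+1) i is Some j then f j else a)).
Proof.
move=> Ff aF; apply: inj_row_free => v.
rewrite mulmx_sum_row big_ord_recl rowK unlift_none.
under eq_bigr => j _ do rewrite rowK liftK.
move=> H; set M := \matrix_i f i in Ff aF.
pose v' : 'rV[R]_k := \row_j v ord0 (lift ord0 j).
have E : v' *m M = \sum_(j < k) v ord0 (lift ord0 j) *: f j.
  by rewrite mulmx_sum_row; apply: eq_bigr => j _; rewrite rowK mxE.
rewrite -E in H.
have v0 : v ord0 ord0 = 0.
  apply: contraNeq aF => v00.
  have -> : a = (- (v ord0 ord0)^-1 *: v') *m M.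
    apply: (scalerI v00); rewrite -scalemxAl scalerA mulrN mulfV // scaleN1r.
    by apply/eqP; rewrite -subr_eq0 opprK H.
  exact: submxMl.
rewrite v0 scale0r add0r in H.
have {}H : v' = 0 by apply: (row_free_inj Ff); rewrite H mul0mx.
apply/rowP => i; rewrite mxE; have [j|] := unliftP ord0 i => ->; last exact: v0.
by have /rowP/(_ j) := H; rewrite !mxE.
Qed.

Lemma span_indep_extend (A : set vec) k (f : 'I_k -> vec) (a : vec) :
    (forall i, A (f i)) -> row_free (\matrix_i f i) -> A a ->
  ~~ (a <= \matrix_i f i)%MS -> span_indep A k.+1.
Proof.
move=> Af Ff Aa aF; exists (fun i => if unlift (ord0 : 'I_k.+1) i is Some j then f j else a).
by split; [move=> i; case: unliftP|exact: row_free_extend].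
Qed.

Lemma span_indep_leq (A : set vec) k p (B : 'M[R]_(p, n.+1)) :
  span_indep A k -> (forall a, A a -> (a <= B)%MS) -> (k <= \rank B)%N.
Proof.
move=> [f [Af]]; rewrite -row_leq_rank => Ff AB; apply: leq_trans Ff _.
by apply: mxrankS; apply/row_subP => i; rewrite rowK; apply: AB.
Qed.

Lemma spandim_basis (A : set vec) k : spandim A k ->
  exists f : 'I_k -> vec, [/\ forall i, A (f i), row_free (\matrix_i f i) &
    forall a, A a -> (a <= \matrix_i f i)%MS].
Proof.
move=> [[f [Af Ff]] maxA]; exists f; split=> // a Aa; apply/negP => /negP aF.
exact: maxA (span_indep_extend Af Ff Aa aF).
Qed.

(* [A] contains a positive multiple of every point near [w] in the row space of
   [W], so it cannot lie in a proper subspace of that row space. *)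
Lemma spandim_open_cone (A : set vec) p (W : 'M[R]_(p, n.+1)) (w : vec) :
    (forall a, A a -> (a <= W)%MS) ->
    (forall d : vec, (d <= W)%MS -> exists t c, [/\ 0 < t, 0 < c & A (c *: (w + t *: d))]) ->
  spandim A (\rank W).
Proof.
move=> AW Aopen; split; last first.
  by move=> /span_indep_leq/(_ AW); rewrite ltnn.
suff H k : (k <= \rank W)%N -> span_indep A k by exact: H.
elim: k => [_|k IH kW].
  exists (fun=> 0); split=> [[]//|]; apply: inj_row_free => v _.
  by apply/rowP => -[].
have [f [Af Ff]] := IH (ltnW kW).
set M := \matrix_i f i in Ff.
have [x xW xM] : exists2 x : vec, (x <= W)%MS & ~~ (x <= M)%MS.
  have : ~~ (W <= M)%MS.
    apply/negP => /mxrankS; rewrite leqNgt; move: Ff => /eqP ->.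
    by rewrite kW.
  by case/row_subPn => i hi; exists (row i W); rewrite ?row_sub.
have [aw|naw] := boolP (w <= M)%MS; last first.
  have [t [c [t0 c0 Ac]]] := Aopen 0 (sub0mx _ _).
  apply: (span_indep_extend Af Ff Ac).
  by rewrite scaler0 addr0; apply: contra naw; rewrite (eqmx_scale w (lt0r_neq0 c0)).
have [t [c [t0 c0 Ac]]] := Aopen x xW.
apply: (span_indep_extend Af Ff Ac).
rewrite (eqmx_scale _ (lt0r_neq0 c0)); apply: contra xM => h.
rewrite -(eqmx_scale x (lt0r_neq0 t0)) -[t *: x](addKr w).
by rewrite addmx_sub // eqmx_opp.
Qed.

(** Matrix of the linear map sending [x] to its products with the [f i], so that [kermx] yields the
    Lorentz-orthogonal complement. *)
Definition lor_mx p (f : 'I_p -> vec) : 'M[R]_(n.+1, p) :=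
  \matrix_(r, i) lor (delta_mx ord0 r) (f i).

Lemma mul_lor_mx p (f : 'I_p -> vec) x i : (x *m lor_mx f) ord0 i = lor x (f i).
Proof.
rewrite [in RHS](row_sum_delta x) lor_suml mxE; apply: eq_bigr => r _.
by rewrite mxE lorZl.
Qed.

Lemma sub_ker_lor_mx p (f : 'I_p -> vec) (x : vec) :
  reflect (forall i, lor x (f i) = 0) (x <= kermx (lor_mx f))%MS.
Proof.
apply: (iffP sub_kermxP) => [h i|h]; first by rewrite -mul_lor_mx h mxE.
by apply/rowP => i; rewrite mul_lor_mx h mxE.
Qed.

(** A relation between the columns is a combination of the [f i] orthogonal to every vector, hence
    zero by [lor_nondeg]. *)
Lemma rank_lor_mx p (f : 'I_p -> vec) :
  row_free (\matrix_i f i) -> \rank (lor_mx f) = p.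
Proof.
move=> Ff; rewrite -mxrank_tr; apply/eqP; apply: inj_row_free => v Hv.
apply: (row_free_inj Ff); rewrite mul0mx; apply: lor_nondeg => y.
rewrite mulmx_sum_row lor_suml.
under eq_bigr => i _ do rewrite rowK lorZl lorC -mul_lor_mx.
transitivity ((v *m (y *m lor_mx f)^T) ord0 ord0).
  by rewrite mxE; apply: eq_bigr => i _; rewrite [_^T _ _]mxE.
by rewrite trmx_mul mulmxA Hv mul0mx mxE.
Qed.

Lemma rank_ker_lor_mx p (f : 'I_p -> vec) :
  row_free (\matrix_i f i) -> \rank (kermx (lor_mx f)) = (n.+1 - p)%N.
Proof. by move=> Ff; rewrite mxrank_ker rank_lor_mx. Qed.

Lemma lor_surj p (f : 'I_p -> vec) (c : 'I_p -> R) :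
  row_free (\matrix_i f i) -> exists x, forall i, lor x (f i) = c i.
Proof.
move=> Ff; have /row_fullP[B BG] : row_full (lor_mx f).
  by rewrite /row_full rank_lor_mx.
exists ((\row_i c i) *m B) => i.
by rewrite -mul_lor_mx -mulmxA BG mulmx1 mxE.
Qed.

Lemma future_perturb (I : finType) (f : I -> vec) (w d : vec) : future w ->
  exists2 t, 0 < t & future (w + t *: d) /\
    forall l, lor w (f l) < 0 -> lor (w + t *: d) (f l) < 0.
Proof.
move=> [ww w0].
have [r r0 Hr] := perturb_lt0 (fun l => lor w (f l)) (fun l => lor d (f l)).
(* The index [true] carries the square norm, [false] the time coordinate; once [t <= 1], the
   quadratic term in [t] is dominated by a linear one. *)
have [q q0 Hq] := perturb_lt0
  (fun b : bool => if b then lor w w else - w ord0 ord0)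
  (fun b : bool => if b then 2 * `|lor w d| + `|lor d d| else `|d ord0 ord0|).
pose t := Num.min (Num.min r q) 1.
have t0 : 0 < t by rewrite /t !lt_min r0 q0 ltr01.
have tr : t <= r by rewrite /t !ge_min lexx.
have tq : t <= q by rewrite /t !ge_min lexx orbT.
have t1 : t <= 1 by rewrite /t !ge_min lexx !orbT.
exists t => //; split=> [|l hl]; last by rewrite lorDl lorZl Hr // t0.
have := Hq true t ww; rewrite t0 tq => /(_ isT) h1.
have := Hq false t; rewrite oppr_lt0 => /(_ w0); rewrite t0 tq => /(_ isT) h2.
split; last first.
  rewrite !mxE; have : t * - d ord0 ord0 <= t * `|d ord0 ord0|.
    by rewrite ler_pM2l // -normrN ler_norm.
  by move: h2; rewrite /=; lra.
rewrite !lor_bilin (lorC d w); move: h1 => /=.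
have : t * lor w d <= t * `|lor w d| by rewrite ler_pM2l // ler_norm.
have : t * (t * lor d d) <= t * `|lor d d|.
  rewrite ler_pM2l //; apply: (@le_trans _ _ (t * `|lor d d|)).
    by rewrite ler_pM2l // ler_norm.
  by rewrite ler_piMl.
lra.
Qed.

End Span.

(** * Planes spanned by two points, and distances to a set *)

Section Pair.
Variables (R : realType) (n : nat).
Notation vec := 'rV[R]_(n.+1).
Implicit Types (x y z d u v w : vec).

Definition pair_mx x y : 'M[R]_(2, n.+1) := \matrix_(i < 2) (if i == ord0 then x else y).

Lemma sub_pair_mx x y d : (d <= pair_mx x y)%MS <-> exists a b, d = a *: x + b *: y.
Proof.
split=> [/submxP[c ->]|[a [b ->]]].
  exists (c ord0 ord0), (c ord0 (lift ord0 ord0)).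
  by rewrite mulmx_sum_row !big_ord_recl big_ord0 !rowK addr0.
rewrite addmx_sub // scalemx_sub //.
  by rewrite -[X in (X <= _)%MS](rowK (fun i : 'I_2 => if i == ord0 then x else y) ord0) row_sub.
by rewrite -[X in (X <= _)%MS](rowK (fun i : 'I_2 => if i == ord0 then x else y) (lift ord0 ord0)) row_sub.
Qed.

Lemma row_free_pair_mx x y :
  (forall a b, a *: x + b *: y = 0 -> a = 0 /\ b = 0) -> row_free (pair_mx x y).
Proof.
move=> h; apply: inj_row_free => v.
rewrite mulmx_sum_row !big_ord_recl big_ord0 !rowK addr0 /= => /h[h0 h1].
apply/rowP => k; rewrite mxE; case: (unliftP ord0 k) => [k' ->|->] //.
by rewrite (ord1 k').
Qed.

(** The Gram determinant [1 - t ^+ 2] is nonzero, as [t = coshd x y] exceeds 1. *)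
Lemma hyp_free x y : hyp x -> hyp y -> x != y -> row_free (pair_mx x y).
Proof.
move=> hx hy xy; apply: row_free_pair_mx => a b h.
have t1 := coshd_gt1 hx hy xy; have [xx _] := hx; have [yy _] := hy.
have hxx : lor (a *: x + b *: y) x = 0 by rewrite h lor0l.
have hyy : lor (a *: x + b *: y) y = 0 by rewrite h lor0l.
move: hxx hyy; rewrite !lor_bilin xx yy (lorC y x) -[lor x y]opprK -/(coshd x y).
set t := coshd x y in t1 * => h1 h2.
have ea : a = - (b * t) by lra.
have : b * (t ^+ 2 - 1) = 0 by move: h2; rewrite ea; lra.
have t2 : t ^+ 2 - 1 != 0 by rewrite gt_eqF // subr_gt0 expr_gt1 // ltW // (lt_trans ltr01).
move/eqP; rewrite mulf_eq0 (negbTE t2) orbF => /eqP b0.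
by rewrite ea b0 mul0r oppr0.
Qed.

Lemma hyp_scale a x : hyp x -> hyp (a *: x) -> a *: x = x.
Proof.
move=> [xx x0] [ax ax0]; have a0 : 0 < a by rewrite mxE pmulr_lgt0 in ax0.
have : a ^+ 2 = 1 by move: ax; rewrite !lor_bilin xx; lra.
by move/eqP; rewrite sqrf_eq1 => /orP[]/eqP a1; [rewrite a1 scale1r|exfalso; lra].
Qed.

Lemma coshdist_pt_le O E x : hyp O -> E `<=` (@hyp R n) -> E x ->
  coshdist_pt O E <= coshd O x.
Proof.
move=> hO hE Ex; apply: ge_inf; last by exists x.
by exists 1 => _ [y Ey <-]; rewrite coshd_ge1 //; apply: hE.
Qed.

Lemma coshdist_pt_ge O (E : set vec) c : E !=set0 ->
  (forall x, E x -> c <= coshd O x) -> c <= coshdist_pt O E.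
Proof.
move=> [x Ex] h; apply: lb_le_inf; first by exists (coshd O x), x.
by move=> _ [y Ey <-]; apply: h.
Qed.

End Pair.

(** * Cones over polytopes and their faces *)

(** The square norm of [x + y] is at least minus its squared time coordinate. This turns a bound on
    time coordinates into a bound on distances. *)
Lemma coshd_le (R : realType) n (x y : 'rV[R]_n.+1) : hyp x -> hyp y ->
  coshd x y <= (x ord0 ord0 + y ord0 ord0) ^+ 2 / 2.
Proof.
move=> [xx _] [yy _]; rewrite /coshd.
have : - ((x + y) ord0 ord0 ^+ 2) <= lor (x + y) (x + y).
  by rewrite [leRHS]/lor -expr2 lerDl sumr_ge0 // => i _; rewrite -expr2 sqr_ge0.
rewrite !lor_bilin xx yy (lorC y x) mxE; lra.
Qed.

Section Cone.
Variables (R : realType) (n m : nat) (e : 'I_m -> 'rV[R]_(n.+1)).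
Notation vec := 'rV[R]_(n.+1).
Implicit Types (S T : {set 'I_m}) (x y z d u v w : vec).

(** Without the hyperboloid condition the constraints are stable under sums and positive multiples;
    [face_normalize] leads back to the polytope. *)
Definition cone x := forall i, lor x (e i) <= 0.

Definition perp S x := forall i, i \in S -> lor x (e i) = 0.

Lemma coneD x y : cone x -> cone y -> cone (x + y).
Proof. by move=> hx hy i; rewrite lorDl; have := hx i; have := hy i; lra. Qed.

Lemma coneZ a x : 0 <= a -> cone x -> cone (a *: x).
Proof. by move=> a0 hx i; rewrite lorZl mulr_ge0_le0. Qed.

Lemma perpD S x y : perp S x -> perp S y -> perp S (x + y).
Proof. by move=> hx hy i iS; rewrite lorDl hx // hy // addr0. Qed.

Lemma perpZ S a x : perp S x -> perp S (a *: x).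
Proof. by move=> hx i iS; rewrite lorZl hx // mulr0. Qed.

Lemma face_perp S x : face e S x -> perp S x.
Proof. by case. Qed.

Lemma face_future S x : face e S x -> future x.
Proof. by case=> -[/hyp_future]. Qed.

Lemma face_cone S x : face e S x -> cone x.
Proof. by case=> -[]. Qed.

Lemma face_normalize S x : future x -> cone x -> perp S x -> face e S (normalize x).
Proof.
move=> fx cx px; split; last exact: perpZ.
by split; [exact: hyp_normalize|apply: coneZ => //; rewrite ltW ?normalize_gt0].
Qed.

Lemma facet_face i : facet e i = face e [set i]%SET.
Proof.
apply/seteqP; split=> x [px hx]; split=> //; last by apply: hx; rewrite inE.
by move=> j; rewrite inE => /eqP ->.
Qed.

Lemma facetI_face i j : facet e i `&` facet e j = face e [set i; j]%SET.
Proof.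
apply/seteqP; split=> x; first move=> [[px hi] [_ hj]].
  by split=> // k; rewrite !inE => /orP[]/eqP->.
by move=> [px hx]; split; split=> //; apply: hx; rewrite !inE eqxx ?orbT.
Qed.

Lemma face_perturb S x d :
    future x -> cone x -> perp S x -> perp S d ->
    (forall i, lor x (e i) = 0 -> lor d (e i) = 0) ->
  exists t, [/\ 0 < t, future (x + t *: d), cone (x + t *: d), perp S (x + t *: d)
    & forall i, lor x (e i) < 0 -> lor (x + t *: d) (e i) < 0].
Proof.
move=> fx cx px pd hd; have [t t0 [ft ht]] := future_perturb e d fx.
exists t; split=> //; last by apply: perpD => //; apply: perpZ.
move=> i; have := cx i; rewrite le_eqVlt => /predU1P[h|/ht/ltW//].
by rewrite lorDl lorZl h hd // mulr0 addr0.
Qed.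

(** Here [x] is a relative interior point: every constraint active at [x] vanishes on the whole
    subspace, so small moves inside the subspace stay in the cone. *)
Lemma face_spandim S x p (W : 'M[R]_(p, n.+1)) :
    future x -> cone x -> perp S x ->
    (forall i, lor x (e i) = 0 -> forall d, perp S d -> lor d (e i) = 0) ->
    (forall d, perp S d <-> (d <= W)%MS) ->
  spandim (face e S) (\rank W).
Proof.
move=> fx cx px hS hW; apply: (@spandim_open_cone _ _ _ _ _ x).
  by move=> a /face_perp; rewrite hW.
move=> d; rewrite -hW => pd.
have [i ?|t [t0 ft ct pt _]] := @face_perturb S x d fx cx px pd; first exact: hS.
exists t, (Num.sqrt (- lor (x + t *: d) (x + t *: d)))^-1.
by split; [|exact: normalize_gt0|exact: face_normalize].
Qed.

(** Adding the witnesses makes all the constraints strict at once, since each is nonpositive at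
    every witness. *)
Lemma face_avoid S (P : pred 'I_m) : face e S !=set0 ->
    (forall i, P i -> exists2 x, face e S x & lor x (e i) < 0) ->
  exists2 x, face e S x & forall i, P i -> lor x (e i) < 0.
Proof.
move=> [x0 fx0] hP.
suff [x fx hx] : exists2 x, face e S x &
    forall i, i \in enum P -> lor x (e i) < 0.
  by exists x => // i Pi; apply: hx; rewrite mem_enum.
have : forall i, i \in enum P -> P i by move=> i; rewrite mem_enum.
elim: (enum P) => [_|k s IH hs]; first by exists x0.
have [i si|x fx hx] := IH; first by apply: hs; rewrite inE si orbT.
have [y fy hy] := hP k (hs k (mem_head _ _)).
have fxy : future (x + y) := futureD (face_future fx) (face_future fy).
exists (normalize (x + y)).
  apply: face_normalize => //; first exact: coneD (face_cone fx) (face_cone fy).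
  exact: perpD (face_perp fx) (face_perp fy).
move=> i; rewrite inE /normalize lorZl (pmulr_rlt0 _ (normalize_gt0 fxy)) lorDl.
have := face_cone fx i; have := face_cone fy i.
by move=> h1 h2 /predU1P[->|/hx]; [move: hy (face_cone fx k)|]; lra.
Qed.

(** * Consequences of compactness *)

Section Compact.
Hypothesis cP : compact_polytope e.

Lemma compact_interior : exists x0, hyp x0 /\ forall i, lor x0 (e i) < 0.
Proof. by case: cP. Qed.

(* If [u] is not timelike, the ray from an interior point towards [u] carries
   points of the polytope arbitrarily far away. *)
Lemma compact_timelike u : cone u -> u != 0 -> lor u u < 0.
Proof.
move=> cu u0; rewrite ltNge; apply/negP => b0.
have [x0 [hx0 x0e]] := compact_interior; have [xx xp] := hx0.
have [C HC] : exists C : R, forall x, polytope e x -> x ord0 ord0 <= C.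
  by case: cP.
(* [N] is the square norm of the component of [u] orthogonal to [x0]; it is positive because [u],
   nonzero and not timelike, is no multiple of [x0]. *)
set b := lor u u in b0; pose a := - lor u x0; pose N := a ^+ 2 + b.
have N0 : 0 < N.
  rewrite /N /a sqrrN addrC (lt_leif (reversed_cauchy u hx0)).
  apply: contraNneq u0 => h; rewrite h; have := b0.
  rewrite /b {}h !lor_bilin xx => h.
  have : (- lor u x0) ^+ 2 = 0 by apply/eqP; rewrite eq_le sqr_ge0 andbT; lra.
  move/eqP; rewrite sqrf_eq0 => /eqP ->; by rewrite mul0r oppr0 scale0r.
pose B := (x0 ord0 ord0 + C) ^+ 2 / 2.
(* Chosen so that the normalized [y] has squared [coshd] from [x0] equal to
   [q ^+ 2 / del = B ^+ 2 + 2], beyond the bound [B] imposed by [coshd_le]. *)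
pose del := N / (B ^+ 2 + 1).
have B1 : 0 < B ^+ 2 + 1 by rewrite ltr_wpDl ?sqr_ge0.
have del0 : 0 < del by exact: divr_gt0.
pose q := Num.sqrt (N + del).
have q2 : q ^+ 2 = N + del by rewrite sqr_sqrtr // addr_ge0 ?ltW.
have q0 : 0 < q by rewrite sqrtr_gt0 addr_gt0.
have r0 : 0 < q - a.
  rewrite subr_gt0; have [a0|a0] := lerP a 0; first exact: le_lt_trans q0.
  by rewrite -ltr_sqr ?nnegrE ?ltW // q2 /N -addrA ltrDl; lra.
pose y := (q - a) *: x0 + u.
have yx : lor y x0 = - q by rewrite /y !lor_bilin xx /a; ring.
have yy : lor y y = - del.
  have -> : lor y y = - (q ^+ 2 - N).
    by rewrite /y !lor_bilin xx (lorC x0 u) -/b /N /a; ring.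
  by rewrite q2; ring.
have fy : future y.
  by apply: (future_of_lor (hyp_future hx0)); rewrite ?yy ?yx oppr_lt0.
have cy : cone y.
  by apply: coneD => //; apply: coneZ => [|i]; rewrite ltW.
have py : perp finset.set0 y by move=> i; rewrite inE.
have [[hp cp] _] := face_normalize fy cy py.
have := coshd_le hx0 hp.
have p0 : 0 < normalize y ord0 ord0 by case: hp.
have pC : normalize y ord0 ord0 <= C by apply: HC; split.
have -> : coshd x0 (normalize y) = (Num.sqrt del)^-1 * q.
  by rewrite /coshd /normalize lorZr lorC yx yy opprK mulrN opprK.
set s := Num.sqrt del; have s0 : 0 < s by rewrite sqrtr_gt0.
move=> h; have {h} : s^-1 * q <= B.
  apply: (le_trans h); rewrite /B ler_pM2r ?invr_gt0 //.
  by rewrite ler_sqr ?nnegrE; lra.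
rewrite mulrC ler_pdivrMr // => h.
have : q ^+ 2 <= (B * s) ^+ 2.
  by rewrite ler_sqr ?nnegrE ?(ltW q0) // (le_trans _ h) // ltW.
rewrite q2 exprMn sqr_sqrtr ?(ltW del0) // .
have : del * (B ^+ 2 + 1) = N by rewrite /del divfK // gt_eqF.
lra.
Qed.

Lemma compact_future x z : future x -> cone z -> lor z x < 0 -> future z.
Proof.
move=> fx cz zx; apply: (future_of_lor fx) => //; apply: compact_timelike => //.
by apply: contraTneq zx => ->; rewrite lor0l ltxx.
Qed.

(** By [compact_timelike] the direction [d] is outside the cone, so some constraint grows along it
    and the ray from [x] meets a facet that does not contain [x]. *)
Lemma compact_exit S x d : future x -> cone x -> perp S x -> perp S d ->
  0 <= lor d d -> d != 0 -> 
  (forall i, lor x (e i) = 0 -> lor d (e i) = 0) -> lor d x = 0 ->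
  exists t w l, [/\ 0 < t, w = x + t *: d, face e S (normalize w), future w
    & lor x (e l) < 0 /\ lor w (e l) = 0].
Proof.
move=> fx cx px pd dd d0 hd dx.
have [l hl] : exists l, 0 < lor d (e l).
  apply: contrapT => h; have : lor d d < 0.
    apply: compact_timelike => // i; rewrite leNgt; apply/negP => hi.
    by apply: h; exists i.
  by rewrite ltNge dd.
have hx i : lor d (e i) != 0 -> lor x (e i) < 0.
  rewrite lt_neqAle cx andbT; apply: contra => /eqP h; exact/eqP/hd.
have [//||s [s0 s1 hs [k xk hk]]] :=
    @first_exit _ _ (fun i => lor x (e i) < 0) (fun i => lor x (e i)) (fun i => lor d (e i)).
  by exists l => //; apply: hx; rewrite gt_eqF.
have s1' : 0 < 1 - s by lra.
pose w' := (1 - s) *: x + s *: d.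
have cw : cone w'.
  move=> i; rewrite /w' lorDl !lorZl.
  have := cx i; rewrite le_eqVlt => /predU1P[h|]; last exact: hs.
  by rewrite h hd // !mulr0 addr0.
(* Dividing by [1 - s] turns the exit point of the segment from [x] to [d] into a point of the
   ray. *)
pose t := s / (1 - s); pose w := x + t *: d.
have ew : w' = (1 - s) *: w.
  by rewrite /w /t scalerDr scalerA mulrCA mulfV ?mulr1 // gt_eqF.
have ew' : w = (1 - s)^-1 *: w' by rewrite ew scalerA mulVf ?scale1r // gt_eqF.
have {}cw : cone w by rewrite ew'; apply: coneZ => //; rewrite invr_ge0 ltW.
have fw : future w.
  apply: (compact_future fx) => //; rewrite /w lorDl lorZl dx mulr0 addr0.
  by have [] := fx.
exists t, w, k; split=> //; first by rewrite /t divr_gt0.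
  by apply: face_normalize => //; apply: perpD => //; apply: perpZ.
by rewrite ew' /w' lorZl lorDl !lorZl hk mulr0.
Qed.

(** Proportional unit normals are equal, against injectivity, or opposite, against the existence of
    an interior point. *)
Lemma compact_normals_nonprop i j : i != j -> forall a b,
  a *: e i + b *: e j = 0 -> a = 0 /\ b = 0.
Proof.
move=> ij.
have [e1 inj _ _ _] := cP; have [x0 [_ x0e]] := compact_interior.
suff H a b k l : k != l -> a *: e k + b *: e l = 0 -> b = 0.
  move=> a b h; split; last exact: H ij h.
  by apply: (H b a j i); rewrite 1?eq_sym // addrC.
move=> kl h; apply: contraNeq kl => b0.
pose c := - (a / b).
have el : e l = c *: e k.
  apply: (scalerI b0); rewrite scalerA /c mulrN mulrC divfK // scaleNr.
  by apply/eqP; rewrite -subr_eq0 opprK addrC h.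
have : c ^+ 2 = 1.
  by have := e1 l; rewrite el !lor_bilin e1 mulr1 -expr2.
move/eqP; rewrite sqrf_eq1 => /orP[]/eqP c1.
  by apply/eqP/inj; rewrite el c1 scale1r.
have := x0e l; have := x0e k; rewrite el c1 lorZr; lra.
Qed.

Lemma row_free_pair i j : i != j ->
  row_free (\matrix_(k < 2) e (if k == ord0 then i else j)).
Proof.
move=> ij; rewrite (_ : \matrix_k _ = pair_mx (e i) (e j)).
  exact/row_free_pair_mx/compact_normals_nonprop.
by apply/row_matrixP => k; rewrite !rowK; case: ifP.
Qed.

(** One relative interior point of the intersection suffices: it makes the span the common
    orthogonal of two independent normals, of dimension [n.+1 - 2]. *)
Lemma adjacent_of_point i j w : i != j -> future w -> cone w ->
    lor w (e i) = 0 -> lor w (e j) = 0 ->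
    (forall l, lor w (e l) = 0 -> forall d, lor d (e i) = 0 -> lor d (e j) = 0 ->
       lor d (e l) = 0) ->
  Defs.adjacent e i j.
Proof.
move=> ij fw cw wi wj hw; split=> //; rewrite facetI_face.
pose f k := e (if k == (ord0 : 'I_2) then i else j).
have -> : n.-1 = \rank (kermx (lor_mx f)).
  by rewrite (rank_ker_lor_mx (row_free_pair ij)) subSS subn1.
apply: (face_spandim fw cw).
- by move=> k; rewrite !inE => /orP[]/eqP ->.
- by move=> l /hw h d pd; apply: h; apply: pd; rewrite !inE eqxx ?orbT.
- move=> d; split=> [pd|/sub_ker_lor_mx h].
    by apply/sub_ker_lor_mx => k; apply: pd; rewrite !inE; case: ifP; rewrite eqxx ?orbT.
  move=> k; rewrite !inE => /orP[]/eqP ->; first exact: (h ord0).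
  exact: (h (lift ord0 ord0)).
Qed.

(** A facet inside a second hyperplane would span dimension at most [n.-1] instead of [n]; hence
    each other constraint is strict somewhere on it, and [face_avoid] applies. *)
Lemma facet_interior i : (0 < n)%N ->
  exists2 x, face e [set i]%SET x & forall j, j != i -> lor x (e j) < 0.
Proof.
move=> n0; have [_ _ _ _ /(_ i)] := cP; rewrite facet_face => -[[f [Ff rf]] _].
apply: face_avoid => [|j ji]; first by exists (f (Ordinal n0)).
apply: contrapT => h.
have fj k : lor (f k) (e j) = 0.
  apply/eqP; rewrite eq_le (face_cone (Ff k)) leNgt; apply/negP => hk.
  by apply: h; exists (f k).
have ij : i != j by rewrite eq_sym.
pose g k := e (if k == (ord0 : 'I_2) then i else j).
have : (\matrix_k f k <= kermx (lor_mx g))%MS.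
  apply/row_subP => k; rewrite rowK; apply/sub_ker_lor_mx => l; rewrite /g.
  by case: ifP => _ //; apply: (face_perp (Ff k)); rewrite inE.
move/mxrankS; rewrite (eqP rf) (rank_ker_lor_mx (row_free_pair ij)) subSS subn1.
by rewrite leqNgt ltn_predL n0.
Qed.

End Compact.
End Cone.

(** * Right-angled polytopes *)

(* Outside [-1, 1] the total function [acos] takes the junk value [0]. *)
Lemma acos_pihalf (R : realType) (x : R) : acos x = pi / 2 -> x = 0.
Proof.
have p0 : 0 < pi / 2 :> R by rewrite divr_gt0 // pi_gt0.
rewrite unlock /=; case: xgetP => [y _ [_ <-] h|_ h]; first by rewrite h cos_pihalf.
by move: p0; rewrite -h ltxx.
Qed.

Lemma orthogonal_dihedral (R : realType) n m (e : 'I_m -> 'rV[R]_n.+1) i j :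
  dihedral e i j = pi / 2 -> lor (e i) (e j) = 0.
Proof. by move/acos_pihalf/eqP; rewrite oppr_eq0 => /eqP. Qed.

Section RightAngled.
Variables (R : realType) (n m : nat) (e : 'I_m -> 'rV[R]_(n.+1)).
Notation vec := 'rV[R]_(n.+1).
Implicit Types (S T : {set 'I_m}) (x y z d u v w : vec).
Hypotheses (n_gt0 : (0 < n)%N) (cP : compact_polytope e) (ra : right_angled e).

Let lor_e i : lor (e i) (e i) = 1.
Proof. by case: cP. Qed.

Lemma adjacent_orthogonal i j : Defs.adjacent e i j -> lor (e i) (e j) = 0.
Proof. by move/ra/orthogonal_dihedral. Qed.

Let active i w := [set l | (l != i) && (lor w (e l) == 0)]%SET.

Let good i w := [/\ future w, cone e w, lor w (e i) = 0, active i w != finset.set0 &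
  forall l, l \in active i w -> ~ Defs.adjacent e i l].

(* Otherwise [good i w] with the fewest active constraints would reduce to an
   interior point of a codimension 2 face in [facet i] and some nonadjacent facet. *)
Let no_good i w : ~ good i w.
Proof.
have [N] := ubnP #|active i w|; elim: N w => // N IH w sN [fw cw wi w0 hw].
have [l lw] := set0Pn _ w0.
have := lw; rewrite inE => /andP[li /eqP wl].
have := hw l lw; apply; apply: (adjacent_of_point cP _ fw cw wi wl).
  by rewrite eq_sym.
(* Used for [d] and [- d], this one-sided bound gives the vanishing that adjacency of [i] and [l]
   requires. *)
suff H l' d : lor w (e l') = 0 -> lor d (e i) = 0 -> lor d (e l) = 0 -> lor d (e l') <= 0.
  move=> l' wl' d di dl; apply/eqP; rewrite eq_le H //= -oppr_le0 -lorNl.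
  by apply: H => //; rewrite lorNl ?di ?dl oppr0.
move=> wl' di dl; rewrite leNgt; apply/negP => dl'.
have [z fz hz] := facet_interior cP i n_gt0.
have zi : lor z (e i) = 0 by apply: (face_perp fz); rewrite inE.
have l'i : l' != i by apply: contraTneq dl' => ->; rewrite di ltxx.
have [||s [s0 s1 hs [k kw hk]]] := @first_exit R _ (fun k => k \in active i w)
    (fun k => lor z (e k)) (fun k => lor d (e k)).
- by move=> k; rewrite inE => /andP[ki _]; apply: hz.
- by exists l' => //; rewrite inE l'i wl' eqxx.
(* On [u] all constraints of [active i w] are nonpositive, [k] vanishes and [l] is negative: moving
   [w] along [u] releases [l] and keeps [k]. *)
pose u := (1 - s) *: z + s *: d.
have [t t0 [ft ht]] := future_perturb e u fw.
have tk k' : lor w (e k') = 0 -> lor (w + t *: u) (e k') = t * lor u (e k').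
  by move=> h; rewrite lorDl lorZl h add0r.
have uE k' : lor u (e k') = (1 - s) * lor z (e k') + s * lor d (e k').
  by rewrite lorDl !lorZl.
have ui : lor u (e i) = 0 by rewrite uE zi di !mulr0 addr0.
have sub : active i (w + t *: u) \proper active i w.
  rewrite properE; apply/andP; split; last first.
    apply/subsetPn; exists l => //; rewrite inE li /= tk // mulf_neq0 ?(gt_eqF t0) //.
    by rewrite lt_eqF // uE dl mulr0 addr0 nmulr_llt0 ?hz //; lra.
  apply/fintype.subsetP => k'; rewrite !inE => /andP[->] /=.
  have := cw k'; rewrite le_eqVlt => /predU1P[->//|/ht].
  by move=> h h'; rewrite (eqP h') ltxx in h.
apply: (IH (w + t *: u)); first exact: leq_trans (proper_card sub) _.
split=> //.
- move=> k'; have := cw k'; rewrite le_eqVlt => /predU1P[h|/ht/ltW//].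
  rewrite tk // pmulr_rle0 //; have [->|k'i] := eqVneq k' i; first by rewrite ui.
  by rewrite uE hs // inE k'i h eqxx.
- by rewrite tk // ui mulr0.
- apply/set0Pn; exists k; move: kw; rewrite !inE => /andP[-> /eqP h] /=.
  by rewrite tk // uE hk mulr0.
- by move=> k' /(fintype.subsetP (proper_sub sub)); apply: hw.
Qed.

(** If the product were positive, the projection [y'] of a point of facet [k] would violate
    constraint [k]; the segment to [y'] from inside facet [i] would then leave through facets not
    adjacent to [i], against [no_good]. *)
Lemma right_angled_obtuse i k : i != k -> lor (e i) (e k) <= 0.
Proof.
move=> ik; rewrite leNgt; apply/negP => eik.
have [y fy hy] := facet_interior cP k n_gt0.
have [z fz hz] := facet_interior cP i n_gt0.
have zi : lor z (e i) = 0 by apply: (face_perp fz); rewrite inE.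
have yk : lor y (e k) = 0 by apply: (face_perp fy); rewrite inE.
pose y' := y - lor y (e i) *: e i.
have y'E l : lor y' (e l) = lor y (e l) - lor y (e i) * lor (e i) (e l).
  by rewrite /y' lorDl lorNl lorZl.
have y'i : lor y' (e i) = 0 by rewrite y'E lor_e; ring.
have y'k : 0 < lor y' (e k).
  by rewrite y'E yk add0r oppr_gt0 nmulr_rlt0 ?hy.
have [l /hz //||s [s0 s1 hs [l li hl]]] := @first_exit R _ (fun l => l != i)
    (fun l => lor z (e l)) (fun l => lor y' (e l)).
  by exists k => //; rewrite eq_sym.
pose w := (1 - s) *: z + s *: y'.
have wE l' : lor w (e l') = (1 - s) * lor z (e l') + s * lor y' (e l').
  by rewrite lorDl !lorZl.
have wi : lor w (e i) = 0 by rewrite wE zi y'i; ring.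
have cw : cone e w.
  by move=> l'; have [->|l'i] := eqVneq l' i; rewrite ?wi // wE hs.
have fw : future w.
  apply: (compact_future cP (face_future fz) cw).
  rewrite lorDl !lorZl /y' lorDl lorNl lorZl [lor (e i) z]lorC zi.
  have := lor_future_lt0 (face_future fy) (face_future fz).
  have [zz _] := face_future fz; move: zz.
  set A := lor z z; set B := lor y z => A0 B0.
  have h1 : 0 < (1 - s) * - A by rewrite mulr_gt0 //; lra.
  have h2 : 0 < s * - B by rewrite mulr_gt0 //; lra.
  lra.
apply: (@no_good i w); split=> //; first by apply/set0Pn; exists l; rewrite inE li wE hl /=.
(* A neighbour [l'] is orthogonal to [i], so the projection keeps its nonpositive value at [y], and
   the segment stays strictly inside it. *)
move=> l'; rewrite inE => /andP[l'i /eqP]; rewrite wE => h /adjacent_orthogonal il'.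
have := hz l' l'i; have := face_cone fy l'; rewrite y'E il' mulr0 subr0 in h.
move=> h1 h2.
have h3 : 0 < (1 - s) * - lor z (e l') by rewrite mulr_gt0 //; lra.
have h4 : 0 <= s * - lor y (e l') by rewrite mulr_ge0 //; lra.
lra.
Qed.

(** The normals active at [v] are independent, so [v] can be moved off all its facets except [i] and
    [j]. *)
Lemma right_angled_adjacent v i j : polytope e v -> i != j ->
  lor v (e i) = 0 -> lor v (e j) = 0 -> Defs.adjacent e i j.
Proof.
move=> [hv cv] ij vi vj; pose T := [set l | lor v (e l) == 0]%SET.
have [x0 [_ x0e]] := compact_interior cP.
pose f (a : 'I_#|T|) := e (enum_val a).
have vf a : lor v (f a) = 0.
  by have := enum_valP a; rewrite inE => /eqP.
have ff a b : a != b -> lor (f a) (f b) <= 0.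
  by move=> ab; apply: right_angled_obtuse; apply: contra ab => /eqP/enum_val_inj ->.
(* The positive part of a linear relation has nonpositive square norm. *)
have rel (c : 'I_#|T| -> R) : \sum_a c a *: f a = 0 -> forall a, c a <= 0.
  move=> hc; pose p := \sum_(a | 0 < c a) c a *: f a.
  have pE : p = \sum_(a | ~~ (0 < c a)) - c a *: f a.
    apply/eqP; rewrite -subr_eq0 -sumrN.
    under eq_bigr => a _ do rewrite scaleNr opprK.
    by have := hc; rewrite (bigID (fun a => 0 < c a)) /= => ->.
  have p0 : p = 0.
    apply/eqP; have pv : lor p v = 0.
      by rewrite lor_suml big1 // => a _; rewrite lorZl lorC vf mulr0.
    have lp := lor_perp hv pv; rewrite -lp eq_le lp /=.
    rewrite {1}/p lor_suml; apply: sumr_le0 => a ca; rewrite lorZl pmulr_rle0 //.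
    rewrite pE lorC lor_suml; apply: sumr_le0 => b cb; rewrite lorZl.
    apply: mulr_ge0_le0; first by rewrite oppr_ge0 leNgt.
    apply: ff.
    by apply: contraTneq ca => <-.
  move=> a; rewrite leNgt; apply/negP => ca.
  (* A positive coefficient would make the product of [p] with the interior point strictly negative,
     while [p] vanishes. *)
  have : lor p x0 < 0.
    rewrite lor_suml (bigD1 a) //= lorZl.
    have h1 : 0 < c a * - lor (f a) x0 by rewrite mulr_gt0 // oppr_gt0 lorC x0e.
    have : \sum_(b | (0 < c b) && (b != a)) lor (c b *: f b) x0 <= 0.
      apply: sumr_le0 => b /andP[cb _]; rewrite lorZl pmulr_rle0 // lorC.
      exact/ltW/x0e.
    lra.
  by rewrite p0 lor0l ltxx.
have Ff : row_free (\matrix_a f a).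
  apply: inj_row_free => c; rewrite mulmx_sum_row.
  under eq_bigr => a _ do rewrite rowK.
  move=> hc; apply/rowP => a; rewrite mxE; apply/eqP.
  rewrite eq_le (rel _ hc) -oppr_le0 //=; apply: (rel (fun a => - c ord0 a)).
  by under eq_bigr => b _ do rewrite scaleNr; rewrite sumrN hc oppr0.
(* The direction stays on the hyperplanes of [i] and [j] and moves strictly inside all other facets
   through [v]. *)
have [d hd] := lor_surj
  (fun a => if (enum_val a == i) || (enum_val a == j) then 0 else -1) Ff.
have dT l : lor v (e l) = 0 -> lor d (e l) = if (l == i) || (l == j) then 0 else -1.
  move=> vl; have lT : l \in T by rewrite inE vl.
  by have := hd (enum_rank_in lT l); rewrite /f enum_rankK_in.
have [t t0 [ft ht]] := future_perturb e d (hyp_future hv).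
have tE l : lor v (e l) = 0 ->
    lor (v + t *: d) (e l) = if (l == i) || (l == j) then 0 else - t.
  by move=> vl; rewrite lorDl lorZl vl dT // add0r; case: ifP; rewrite ?mulr0 // mulrN1.
apply: (adjacent_of_point cP ij ft).
- move=> l; have := cv l; rewrite le_eqVlt => /predU1P[/tE ->|/ht/ltW//].
  by case: ifP => // _; rewrite oppr_le0 ltW.
- by rewrite tE // eqxx.
- by rewrite tE // eqxx orbT.
- move=> l; have := cv l; rewrite le_eqVlt => /predU1P[/tE ->|/ht h h0]; last first.
    by rewrite h0 ltxx in h.
  case: ifP => [/orP[]/eqP -> //|_ /eqP]; by rewrite oppr_eq0 gt_eqF.
Qed.

Lemma right_angled_orthogonal v i j : polytope e v -> i != j ->
  lor v (e i) = 0 -> lor v (e j) = 0 -> lor (e i) (e j) = 0.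
Proof. by move=> pv ij vi vj; apply/adjacent_orthogonal/right_angled_adjacent/vj. Qed.

End RightAngled.

(** * Edges *)

Section Edges.
Variables (R : realType) (n m : nat) (e : 'I_m -> 'rV[R]_(n.+1)).
Notation vec := 'rV[R]_(n.+1).
Implicit Types (S T : {set 'I_m}) (x y z d u v w O : vec) (E : set vec).
Hypothesis (cP : compact_polytope e).

Let lor_e i : lor (e i) (e i) = 1.
Proof. by case: cP. Qed.

Lemma width_le i j v w : facet e i v -> facet e j w -> width e i j <= coshd v w.
Proof.
move=> fv fw; apply: ge_inf; last by exists v => //; exists w.
by exists 1 => _ [x [[hx _] _]] [y [[hy _] _]] <-; rewrite coshd_ge1.
Qed.

Definition orthogonal_on T :=
  forall i j, i \in T -> j \in T -> i != j -> lor (e i) (e j) = 0.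

(** This is the orthogonal projection onto the complement of the normals in [T] only when these are
    pairwise orthogonal unit vectors. *)
Definition proj T O := O - \sum_(k in T) lor O (e k) *: e k.

Lemma lor_proj_perp T O x : perp e T x -> lor (proj T O) x = lor O x.
Proof.
move=> hx; rewrite lorDl lorNl lor_suml big1 ?subr0 // => k kT.
by rewrite lorZl (lorC (e k)) hx // mulr0.
Qed.

Lemma perp_proj T O : orthogonal_on T -> perp e T (proj T O).
Proof.
move=> oT i iT; rewrite lorDl lorNl lor_suml (bigD1 i) //= lorZl lor_e mulr1.
rewrite big1 ?addr0 ?subrr // => k /andP[kT ki].
by rewrite lorZl oT // mulr0.
Qed.

Lemma lor_proj T O : orthogonal_on T ->
  lor (proj T O) (proj T O) = lor O O - \sum_(k in T) lor O (e k) ^+ 2.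
Proof.
move=> oT; rewrite lor_proj_perp; last exact: perp_proj.
rewrite lorC lorDl lorNl lor_suml; congr (_ - _).
by apply: eq_bigr => k _; rewrite lorZl (lorC (e k)).
Qed.

(** The bound is the distance to the whole subspace, wherever the foot of the perpendicular falls;
    it comes from [reversed_cauchy] applied to the projection. *)
Lemma coshdist_pt_face_ge T O : hyp O -> orthogonal_on T -> face e T !=set0 ->
  Num.sqrt (1 + \sum_(k in T) lor O (e k) ^+ 2) <= coshdist_pt O (face e T).
Proof.
move=> hO oT ne; apply: coshdist_pt_ge => // x fx.
have [[hx _] px] := fx; have [OO _] := hO.
have c0 : 0 <= coshd O x by rewrite (le_trans ler01) ?coshd_ge1.
rewrite -(ger0_norm c0) -sqrtr_sqr ler_wsqrtr // /coshd sqrrN.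
have := reversed_cauchy (proj T O) hx => -[].
by rewrite lor_proj // lor_proj_perp // OO => h _; lra.
Qed.

(** The normalized projection is then a point of the face, at exactly this distance. *)
Lemma coshdist_pt_face_le T O : hyp O -> orthogonal_on T -> future (proj T O) ->
    cone e (proj T O) ->
  coshdist_pt O (face e T) <= Num.sqrt (1 + \sum_(k in T) lor O (e k) ^+ 2).
Proof.
move=> hO oT fp cp; have pp := perp_proj O oT; have [OO _] := hO.
have := face_normalize fp cp pp => /(coshdist_pt_le hO).
move=> /(_ (fun x fx => (fx.1).1))/le_trans; apply.
rewrite /coshd /normalize lorZr -(lor_proj_perp O pp) lor_proj // OO.
set A := 1 + _; have -> : -1 - \sum_(k in T) lor O (e k) ^+ 2 = - A by rewrite /A; ring.
have A0 : 0 < A by rewrite ltr_pwDl // sumr_ge0 // => k _; exact: sqr_ge0.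
rewrite opprK mulrN opprK -{2}(sqr_sqrtr (ltW A0)) expr2 mulKf //.
by rewrite gt_eqF // sqrtr_gt0.
Qed.

(** By orthogonality, moving [v] along [- e k] leaves facet [k] and no other facet of [T]; the new
    face spans the plane of [v] and [e k]. *)
Lemma edge_of_vertex T v k : polytope e v -> perp e T v -> orthogonal_on T ->
    (forall l, l \notin T -> lor v (e l) < 0) ->
    (forall d, perp e T d -> exists a, d = a *: v) -> k \in T ->
  is_edge e (face e (T :\ k)%SET).
Proof.
move=> [hv cv] pv oT nT sT kT; exists (T :\ k)%SET; split=> //.
have [t t0 [ft ht]] := future_perturb e (- e k) (hyp_future hv).
set x := v + t *: - e k in ft ht.
have xT l : l \in T -> lor x (e l) = if l == k then - t else 0.
  move=> lT; rewrite lorDl lorZl lorNl pv // add0r.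
  case: eqVneq => [->|lk]; first by rewrite lor_e mulrN1.
  by rewrite oT // 1?eq_sym // oppr0 mulr0.
have xN l : l \notin (T :\ k)%SET -> lor x (e l) < 0.
  rewrite !inE negb_and negbK; have [lT|lT _] := boolP (l \in T); last exact/ht/nT.
  by rewrite orbF => /eqP ->; rewrite xT // eqxx oppr_lt0.
have xP : perp e (T :\ k)%SET x.
  by move=> l; rewrite !inE => /andP[lk lT]; rewrite xT // (negbTE lk).
have rW : row_free (pair_mx v (e k)).
  apply: row_free_pair_mx => a b h; have [vv _] := hv.
  have h1 : lor (a *: v + b *: e k) v = 0 by rewrite h lor0l.
  have h2 : lor (a *: v + b *: e k) (e k) = 0 by rewrite h lor0l.
  by move: h1 h2; rewrite !lor_bilin vv lor_e (lorC (e k) v) pv //; lra.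
have -> : 2%N = \rank (pair_mx v (e k)) by rewrite (eqP rW).
apply: (face_spandim ft) => //.
- move=> l; have [lS|/xN/ltW//] := boolP (l \in (T :\ k)%SET).
  by rewrite xP.
- move=> l xl d; apply; apply: contraTT isT => /xN.
  by rewrite xl ltxx.
- move=> d; rewrite sub_pair_mx; split=> [pd|[a [b ->]]].
    have [|a ha] := sT (d - lor d (e k) *: e k).
      move=> l lT; rewrite !lor_bilin; have [->|lk] := eqVneq l k.
        by rewrite lor_e mulr1 subrr.
      by rewrite pd ?inE ?lk // oT // 1?eq_sym // mulr0 subrr.
    by exists a, (lor d (e k)); rewrite -ha subrK.
  apply: perpD; apply: perpZ => l; rewrite !inE => /andP[lk lT]; first exact: pv.
  by apply: oT => //; rewrite eq_sym.
Qed.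

Definition facets_of E := [set i | `[< contains e E i >]]%SET.

(** Replaces the arbitrary set in [is_edge] by the largest one, so that every remaining constraint
    is strict somewhere on the edge. *)
Lemma edge_facets E : is_edge e E -> E = face e (facets_of E).
Proof.
move=> [S [ES _]]; apply/seteqP; split=> x Ex.
  split; first by move: Ex; rewrite ES => -[].
  by move=> i; rewrite inE => /asboolP/(_ x Ex)[].
rewrite ES; split=> [|i iS]; first by case: Ex.
apply: (face_perp Ex); rewrite inE; apply/asboolP => y.
by rewrite ES => -[py hy]; split=> //; apply: hy.
Qed.

Lemma edge_two_points E : is_edge e E -> exists x y, [/\ E x, E y & x != y].
Proof.
move=> [S [_ [[f [Ef Ff]] _]]]; exists (f ord0), (f (lift ord0 ord0)); split=> //.
apply: contraTneq isT => h.
have : \row_(i < 2) (if i == ord0 then 1 else -1 : R) = 0.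
  apply: (row_free_inj Ff); rewrite mul0mx mulmx_sum_row !big_ord_recl big_ord0.
  by rewrite !rowK !mxE /= h scale1r scaleN1r addr0 subrr.
by move/rowP/(_ ord0); rewrite !mxE /= => /eqP; rewrite oner_eq0.
Qed.

Lemma edge_interior E : is_edge e E ->
  exists2 x, E x & forall i, i \notin facets_of E -> lor x (e i) < 0.
Proof.
move=> eE; have [x [_ [Ex _ _]]] := edge_two_points eE.
rewrite {1}(edge_facets eE).
apply: (@face_avoid _ _ _ _ _ (fun i => i \notin facets_of E)).
  by exists x; rewrite -edge_facets.
move=> i; rewrite inE => /asboolPn hi; apply: contrapT => h; apply: hi => y Ey.
have [py _] : face e (facets_of E) y by rewrite -edge_facets.
split=> //; apply/eqP; rewrite eq_le (py.2 i) leNgt; apply/negP => yi.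
by apply: h; exists y; rewrite // -edge_facets.
Qed.

(** Moving a relative interior point along [d] stays in the cone over [E], so [d] lies in the span
    of [E]; that span is a plane, generated by the independent [y] and [z]. *)
Lemma edge_span E y z d : is_edge e E -> E y -> E z -> y != z ->
  perp e (facets_of E) d -> exists a b, d = a *: y + b *: z.
Proof.
move=> eE Ey Ez yz pd; have [x Ex xN] := edge_interior eE.
have [S [_ /spandim_basis[f [Ef Ff sE]]]] := eE.
have EF := edge_facets eE.
have hE u : E u -> face e (facets_of E) u by rewrite -EF.
have [[hy _] _] := hE y Ey; have [[hz _] _] := hE z Ez; have fx := hE x Ex.
apply/sub_pair_mx; set M := \matrix_i f i in Ff sE.
have rp := hyp_free hy hz yz.
have pM : (pair_mx y z <= M)%MS.
  by apply/row_subP => i; rewrite rowK; case: ifP => _; apply: sE.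
have Mp : (M <= pair_mx y z)%MS.
  by rewrite -(geq_leqif (mxrank_leqif_sup pM)) (eqP Ff) (eqP rp).
apply: submx_trans Mp.
have [|t [t0 ft ct pt _]] := face_perturb (face_future fx) (face_cone fx) (face_perp fx) pd.
  move=> i xi; apply: pd; apply: contraTT isT => /xN.
  by rewrite xi ltxx.
have := sE (normalize (x + t *: d)); rewrite {1}EF => /(_ (face_normalize ft ct pt)).
rewrite /normalize (eqmx_scale _ (lt0r_neq0 (normalize_gt0 ft))) => h.
rewrite -(eqmx_scale d (lt0r_neq0 t0)) -[t *: d](addKr x).
by rewrite addmx_sub // eqmx_opp sE.
Qed.

End Edges.

(* [1 + S] is [- lor p p] for [p = a v + b w] with [coshd v w = t]; [S] is a sum of
   at least [N] terms, each bounding the squares of [lor O] at both framing normals. *)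
Lemma outermost_arith (R : realType) (a b t S N : R) : 0 < a -> 0 < b -> 1 < t ->
    1 + S = a ^+ 2 + b ^+ 2 + 2 * a * b * t ->
    N * (a ^+ 2 * (t ^+ 2 - 1)) <= S -> N * (b ^+ 2 * (t ^+ 2 - 1)) <= S ->
  N * (t - 1) < 2.
Proof.
(* By symmetry the hypothesis carrying the larger coefficient may be used. *)
wlog ab : a b / b <= a => [H|].
  have [ab|/ltW ba] := lerP b a; first exact: H.
  move=> a0 b0 t1 h1 h2 h3; apply: (H b a) => //; rewrite h1; ring.
move=> a0 b0 t1 h1 h2 _.
have h3 : b ^+ 2 <= a ^+ 2 by rewrite ler_sqr // nnegrE ltW.
have h4 : a * b * t <= a * a * t by rewrite ler_pM2r ?ler_pM2l //; lra.
have q0 : 0 < a ^+ 2 * (t + 1) by rewrite mulr_gt0 ?exprn_gt0 //; lra.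
(* After multiplication by [a ^+ 2 * (t + 1)] the left side is at most [S], which is less than
   [2 * a ^+ 2 * (t + 1)] because of the 1 in [1 + S]. *)
rewrite -(ltr_pM2r q0); apply: (@le_lt_trans _ _ S); last by lra.
by apply: le_trans h2; rewrite le_eqVlt; apply/orP; left; apply/eqP; ring.
Qed.

(** * Framing facets of a right-angled ridge and the exchange of edges *)

Section Ridge.
Variables (R : realType) (n m : nat) (e : 'I_m -> 'rV[R]_(n.+1)).
Notation vec := 'rV[R]_(n.+1).
Implicit Types (S T : {set 'I_m}) (x y z d u v w O : vec) (E : set vec).
Hypothesis (cP : compact_polytope e).

Let lor_e i : lor (e i) (e i) = 1.
Proof. by case: cP. Qed.

Section Edge.
Variable E : set vec.
Hypothesis (eE : is_edge e E).
Let T := facets_of e E.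

Let ET x : E x -> face e T x.
Proof. by rewrite {1}(edge_facets eE). Qed.

Let E_hyp x : E x -> hyp x.
Proof. by move=> /ET[[]]. Qed.

Lemma coshd_sqr_gt1 v w : E v -> E w -> v != w -> 0 < coshd v w ^+ 2 - 1.
Proof.
move=> Ev Ew vw; have t1 := coshd_gt1 (E_hyp Ev) (E_hyp Ew) vw.
by rewrite subr_gt0 expr_gt1 // ltW // (lt_trans ltr01).
Qed.

(** The normal is a unit vector of the plane of [v] and [w] orthogonal to [v], hence known up to
    sign; the constraint at [w] fixes the sign. *)
Lemma framing_normal v w i : E v -> E w -> v != w -> perp e T (e i) ->
    lor v (e i) = 0 ->
  e i = - (Num.sqrt (coshd v w ^+ 2 - 1))^-1 *: (w - coshd v w *: v).
Proof.
move=> Ev Ew vw pi vi; have t0 := coshd_sqr_gt1 Ev Ew vw.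
have [a [b hi]] := edge_span eE Ev Ew vw pi.
have [vv _] := E_hyp Ev; have [ww _] := E_hyp Ew.
have wi := (ET Ew).1.2 i.
move: t0 vi wi (lor_e i); rewrite hi !lor_bilin vv ww (lorC w v).
rewrite -[lor v w]opprK -/(coshd v w); set t := coshd v w => t0 h1 h2 h3.
have ea : a = - (b * t) by lra.
have b0 : 0 < - b.
  rewrite ea in h2; rewrite lt_neqAle; apply/andP; split.
    apply: contraTneq isT => /esym/eqP; rewrite oppr_eq0 => /eqP b0.
    by move: h3; rewrite ea b0 !(mul0r, oppr0, addr0) => /esym/eqP; rewrite oner_eq0.
  rewrite oppr_ge0 -(pmulr_lle0 _ t0); lra.
have eb : - b = (Num.sqrt (t ^+ 2 - 1))^-1.
  apply: (@mulIf _ (Num.sqrt (t ^+ 2 - 1))); first by rewrite gt_eqF // sqrtr_gt0.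
  rewrite mulVf ?gt_eqF ?sqrtr_gt0 // -(ger0_norm (ltW b0)) -sqrtr_sqr -sqrtrM ?sqr_ge0 //.
  rewrite (_ : _ * _ = 1) ?sqrtr1 //; rewrite -[RHS]h3 ea; ring.
by rewrite -eb opprK ea scalerBr scalerA scaleNr addrC.
Qed.

(** The square root is the hyperbolic sine of the distance between [v] and [w]. *)
Lemma lor_framing v w i : E v -> E w -> v != w -> perp e T (e i) ->
  lor v (e i) = 0 -> lor w (e i) = - Num.sqrt (coshd v w ^+ 2 - 1).
Proof.
move=> Ev Ew vw pi vi; have t0 := coshd_sqr_gt1 Ev Ew vw.
have [ww _] := E_hyp Ew.
rewrite (framing_normal Ev Ew vw pi vi) !lor_bilin ww (lorC w v).
rewrite -[lor v w]opprK -/(coshd v w); set t := coshd v w in t0 *.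
set s := Num.sqrt _; have s0 : s != 0 by rewrite gt_eqF // sqrtr_gt0.
have s2 : t ^+ 2 - 1 = s ^+ 2 by rewrite sqr_sqrtr // ltW.
apply: (mulfI s0); rewrite mulrA mulrN mulfV // [RHS]mulrN -[s * s]expr2 -s2; ring.
Qed.

Section RightAngledRidge.
Variable (O : vec).
Hypotheses (iO : interior_point e O) (oE : outermost e O E) (rE : right_angled_ridge e E).

Lemma ridge_orthogonal k l : k \in T -> in_ridge e E l -> k != l -> lor (e k) (e l) = 0.
Proof.
move=> kT rl kl; have ck : contains e E k by move: kT; rewrite inE => /asboolP.
by apply/orthogonal_dihedral/rE => //; [left|case=> -[]].
Qed.

Lemma facets_of_orthogonal : orthogonal_on e T.
Proof.
move=> k l kT lT kl; apply: ridge_orthogonal => //; left.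
by move: lT; rewrite inE => /asboolP.
Qed.

Lemma framing_notin i : framing e E i -> i \notin T.
Proof. by case=> _ h; rewrite inE; apply/asboolPn. Qed.

Lemma framing_perp i : framing e E i -> perp e T (e i).
Proof.
move=> fi k kT; rewrite lorC; apply: ridge_orthogonal => //; first by right.
by apply: contraNneq (framing_notin fi) => <-.
Qed.

(** [framing_normal] expresses both normals by the same formula in [v] and [w]. *)
Lemma framing_unique v w i j : E v -> E w -> v != w -> framing e E i -> framing e E j ->
  lor v (e i) = 0 -> lor v (e j) = 0 -> i = j.
Proof.
move=> Ev Ew vw fi fj vi vj; have [_ inj _ _ _] := cP; apply: inj.
rewrite (framing_normal Ev Ew vw (framing_perp fi) vi).
by rewrite (framing_normal Ev Ew vw (framing_perp fj) vj).
Qed.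

Let p := proj e T O.

Let lor_p x : perp e T x -> lor p x = lor O x.
Proof. exact: lor_proj_perp. Qed.

(** The framing normals are orthogonal to those in [T], so [p] and [O] have equal products with
    them; these are negative and determine [a] and [b]. *)
Lemma proj_coords v w i j : E v -> E w -> v != w -> framing e E i -> framing e E j ->
    lor v (e i) = 0 -> lor w (e j) = 0 ->
  exists a b, [/\ 0 < a, 0 < b, p = a *: v + b *: w,
    lor O (e i) ^+ 2 = b ^+ 2 * (coshd v w ^+ 2 - 1) &
    lor O (e j) ^+ 2 = a ^+ 2 * (coshd v w ^+ 2 - 1)].
Proof.
move=> Ev Ew vw fi fj vi wj; have t0 := coshd_sqr_gt1 Ev Ew vw.
have [a [b pE]] := edge_span eE Ev Ew vw (perp_proj cP O facets_of_orthogonal).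
have [_ Oe] := iO.
have wi := lor_framing Ev Ew vw (framing_perp fi) vi.
have vj := lor_framing Ew Ev; rewrite eq_sym in vj.
have {}vj := vj j vw (framing_perp fj) wj.
have tC : coshd w v = coshd v w by rewrite /coshd lorC.
rewrite tC in vj.
have pi := lor_p (framing_perp fi); have pj := lor_p (framing_perp fj).
rewrite {1}/p pE lorDl !lorZl vi wi mulr0 add0r in pi.
rewrite {1}/p pE lorDl !lorZl vj wj mulr0 addr0 in pj.
have s0 : 0 < Num.sqrt (coshd v w ^+ 2 - 1) by rewrite sqrtr_gt0.
exists a, b; split=> //.
- by have := Oe j; rewrite -pj mulrN oppr_lt0 pmulr_lgt0.
- by have := Oe i; rewrite -pi mulrN oppr_lt0 pmulr_lgt0.
- by rewrite -pi mulrN sqrrN exprMn sqr_sqrtr // ltW.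
- by rewrite -pj mulrN sqrrN exprMn sqr_sqrtr // ltW.
Qed.

Hypotheses (fp : future p) (cp : cone e p).

(* Exchanging a facet [k] around the edge for the framing facet [i] gives an edge
   at the vertex [v], which is not further from [O]. *)
Lemma outermost_framing_le v w i k : E v -> E w -> v != w -> is_vertex e v ->
    framing e E i -> lor v (e i) = 0 -> k \in T ->
  lor O (e i) ^+ 2 <= lor O (e k) ^+ 2.
Proof.
move=> Ev Ew vw vV fi vi kT; have [hO _] := iO.
have [pv pTv] := ET Ev; have iT := framing_notin fi.
pose U := (i |: T)%SET.
have wi := lor_framing Ev Ew vw (framing_perp fi) vi.
have pU : perp e U v by move=> l /setU1P[->//|]; apply: pTv.
have oU : orthogonal_on e U.
  move=> a b /setU1P[->|aT] /setU1P[->|bT] ab; first by rewrite eqxx in ab.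
  - exact: framing_perp.
  - by rewrite lorC; apply: framing_perp.
  - exact: facets_of_orthogonal.
(* Any other facet through [v] would be a second framing facet there. *)
have nU l : l \notin U -> lor v (e l) < 0.
  rewrite !inE negb_or => /andP[li lT]; rewrite lt_neqAle pv.2 andbT.
  apply: contraNneq li => vl; apply/eqP/(framing_unique Ev Ew vw) => //; split.
    by exists v; split.
  by move/asboolPn: lT.
have sU d : perp e U d -> exists a, d = a *: v.
  move=> pd; have [|a [b dE]] := edge_span (d := d) eE Ev Ew vw.
    by move=> l lT; apply: pd; rewrite inE lT orbT.
  exists a; have := pd i; rewrite dE lorDl !lorZl vi wi mulr0 add0r.
  rewrite setU11 => /(_ isT)/eqP; rewrite mulf_eq0 oppr_eq0 sqrtr_eq0.
  by rewrite leNgt coshd_sqr_gt1 // orbF => /eqP ->; rewrite scale0r addr0.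
have kU : k \in U by rewrite inE kT orbT.
have eS := edge_of_vertex cP pv pU oU nU sU kU.
have [_ /(_ _ eS)] := oE.
have oS : orthogonal_on e (U :\ k)%SET.
  by move=> a b; rewrite !in_setD1 => /andP[_ aU] /andP[_ bU]; apply: oU.
have neS : face e (U :\ k)%SET !=set0.
  exists v; split=> // l; rewrite in_setD1 => /andP[_]; apply: pU.
(* The lower bound for the new edge meets the upper bound for [E]; the two sums differ only in the
   terms of [i] and [k]. *)
have h1 := coshdist_pt_face_ge cP hO oS neS.
have h2 := coshdist_pt_face_le cP hO facets_of_orthogonal fp cp.
rewrite -/T -(edge_facets eE) in h2.
move=> /(le_trans h1)/le_trans/(_ h2).
rewrite ler_sqrt; last first.
  by rewrite addr_ge0 // sumr_ge0 // => l _; exact: sqr_ge0.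
rewrite lerD2l.
have := big_setU1 _ iT : \sum_(l in U) lor O (e l) ^+ 2 = _.
rewrite (big_setD1 k kU) /=; lra.
Qed.

End RightAngledRidge.
End Edge.
End Ridge.

(** * The width bound, and existence of vertices, edges and framing facets *)

Section Main.
Variables (R : realType) (n m : nat) (e : 'I_m -> 'rV[R]_(n.+1)).
Notation vec := 'rV[R]_(n.+1).
Implicit Types (S T : {set 'I_m}) (x y z d u v w O : vec) (E : set vec).
Hypothesis (cP : compact_polytope e).

(** The normals in [T] and two points of [E] span the whole space, since the projection of any
    vector lies in the plane of [E]; hence [n.+1 <= #|T| + 2]. *)
Lemma card_facets_of E : is_edge e E -> orthogonal_on e (facets_of e E) ->
  (n.-1 <= #|facets_of e E|)%N.
Proof.
move=> eE oT; set T := facets_of e E.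
have [v [w [Ev Ew vw]]] := edge_two_points eE.
pose M := \matrix_(a < #|T|) e (enum_val a).
have sub k : k \in T -> (e k <= M)%MS.
  move=> kT; rewrite -[k](enum_rankK_in kT) //.
  by rewrite -(rowK (fun a : 'I_#|T| => e (enum_val a))) row_sub.
have full : (1%:M <= M + pair_mx v w)%MS.
  apply/row_subP => r; set x := row r _.
  rewrite -[x](subrK (\sum_(k in T) lor x (e k) *: e k)) addrC -/(proj e T x).
  apply: addmx_sub_adds.
    by apply: summx_sub => k kT; apply/scalemx_sub/sub.
  exact/sub_pair_mx/(edge_span eE Ev Ew vw)/(perp_proj cP).
have := mxrankS full; rewrite mxrank1 => /leq_trans.
move=> /(_ _ (mxrank_adds_leqif _ _)).
move=> /leq_trans/(_ (leq_add (rank_leq_row M) (rank_leq_row (pair_mx v w)))).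
by rewrite addn2 !ltnS; case: (n).
Qed.

Lemma outermost_width O E i j : (1 < n)%N -> interior_point e O -> outermost e O E ->
    right_angled_ridge e E -> i != j -> framing e E i -> framing e E j ->
  width e i j < n.+1%:R / n.-1%:R.
Proof.
move=> n1 iO oE rE ij fi fj; have [eE _] := oE.
have [[v [vV Ev vi]] _] := fi; have [[w [wV Ew wj]] _] := fj.
have {}vi := vi.2; have {}wj := wj.2.
have ET x : E x -> face e (facets_of e E) x by rewrite {1}(edge_facets eE).
(* If both framing facets met [E] at one point, [framing_unique] with a second point of [E] would
   identify them. *)
have vw : v != w.
  apply: contra ij => /eqP vw; rewrite -vw in wj.
  have [y [z [Ey Ez yz]]] := edge_two_points eE.
  have [x Ex vx] : exists2 x, E x & v != x.
    have [vy|] := eqVneq v y; last by exists y.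
    by exists z; rewrite // vy.
  exact/eqP/(framing_unique cP eE rE Ev Ex vx).
have wv : w != v by rewrite eq_sym.
have [a [b [a0 b0 pE ci cj]]] := proj_coords cP eE iO rE Ev Ew vw fi fj vi wj.
have [hv cv] := (ET v Ev).1; have [hw cw] := (ET w Ew).1.
have fp : future (proj e (facets_of e E) O).
  by rewrite pE; apply: futureD; apply: futureZ => //; apply: hyp_future.
have cp : cone e (proj e (facets_of e E) O).
  by rewrite pE; apply: coneD; apply: coneZ; rewrite ?ltW.
have oT := facets_of_orthogonal rE.
have hi k := outermost_framing_le cP eE iO oE rE fp cp Ev Ew vw vV fi vi (k := k).
have hj k := outermost_framing_le cP eE iO oE rE fp cp Ew Ev wv wV fj wj (k := k).
have t1 := coshd_gt1 hv hw vw.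
have hsum : 1 + \sum_(k in facets_of e E) lor O (e k) ^+ 2
    = a ^+ 2 + b ^+ 2 + 2 * a * b * coshd v w.
  have := lor_proj cP O oT; rewrite {1 2}pE !lor_bilin.
  have [-> _] := hv; have [-> _] := hw; have [[-> _] _] := iO.
  by rewrite (lorC w v) -[lor v w]opprK -/(coshd v w); lra.
have hcard c : (forall k, k \in facets_of e E -> c <= lor O (e k) ^+ 2) -> 0 <= c ->
    n.-1%:R * c <= \sum_(k in facets_of e E) lor O (e k) ^+ 2.
  move=> hc c0; apply: (@le_trans _ _ (#|facets_of e E|%:R * c)).
    by rewrite ler_wpM2r // ler_nat card_facets_of.
  by rewrite mulr_natl -sumr_const; apply: ler_sum.
have := outermost_arith a0 b0 t1 hsum.
rewrite -ci -cj => /(_ n.-1%:R (hcard _ hj (sqr_ge0 _)) (hcard _ hi (sqr_ge0 _))) h.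
have pv : facet e i v by [].
have pw : facet e j w by [].
(* The end points lie on the two framing facets, so the length of the edge bounds the width. *)
apply: (le_lt_trans (width_le pv pw)).
have n0 : 0 < n.-1%:R :> R by rewrite ltr0n; case: (n) n1 => [|[]].
rewrite ltr_pdivlMr //.
have -> : n.+1%:R = n.-1%:R + 2 :> R.
  by rewrite -natrD addn2; congr (_%:R); case: (n) n1.
lra.
Qed.

(** For a nonempty face with [S] of largest cardinality, no constraint outside [S] is active on it;
    a direction in its span independent of [v] would let [compact_exit] reach such a constraint. *)
Lemma exists_vertex : exists v S, [/\ face e S v,
  forall l, l \notin S -> lor v (e l) < 0 & forall d, perp e S d -> exists a, d = a *: v].
Proof.
have [x0 [hx0 x0e]] := compact_interior cP.
have P0 : `[< face e finset.set0 !=set0 >].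
  by apply/asboolP; exists x0; split=> [|i]; [split=> // i; rewrite ltW|rewrite inE].
case: (@arg_maxnP _ finset.set0 (fun S => `[< face e S !=set0 >]) (fun S => #|S|) P0).
move=> S /asboolP[v fv] Smax; exists v, S.
have noS l z : l \notin S -> face e S z -> lor z (e l) != 0.
  move=> lS fz; apply/eqP => zl.
  have /Smax : `[< face e (l |: S)%SET !=set0 >].
    apply/asboolP; exists z; split; first by case: fz.
    by move=> k /setU1P[->//|]; apply: (face_perp fz).
  by rewrite /= cardsU1 lS /= add1n ltnn.
have nS l : l \notin S -> lor v (e l) < 0.
  by move=> lS; rewrite lt_neqAle noS // (face_cone fv).
split=> // d pd; have [[hv _] pv] := fv; have [vv _] := hv.
exists (- lor d v); apply/eqP; rewrite -subr_eq0 scaleNr opprK; apply: contrapT => /negP d0.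
have dv : lor (d + lor d v *: v) v = 0 by rewrite !lor_bilin vv; ring.
have [||||t [w [l [_ _ fw ffw [vl wl]]]]] := compact_exit cP (hyp_future hv)
    (face_cone fv) pv (d := d + lor d v *: v) _ _ d0.
- by apply: perpD => //; apply: perpZ.
- by have [] := lor_perp hv dv.
- move=> i; have [iS _|/nS h h0] := boolP (i \in S); last by rewrite h0 ltxx in h.
  by rewrite lorDl lorZl pd // pv // mulr0 addr0.
- by [].
have lS : l \notin S by apply: contraTN vl => lS; rewrite pv // ltxx.
by have := noS _ _ lS fw; rewrite /normalize lorZl wl mulr0 eqxx.
Qed.

(** Following [d] inside the edge until the exit point yields an end point; the constraint met there
    rises from negative to zero, whence the sign. *)
Lemma edge_endpoint E x d : is_edge e E -> E x ->
    (forall i, i \notin facets_of e E -> lor x (e i) < 0) ->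
    perp e (facets_of e E) d -> 0 < lor d d -> lor d x = 0 ->
  exists2 l, framing e E l & 0 < lor d (e l).
Proof.
move=> eE Ex xN pd dd dx.
have ET z : E z -> face e (facets_of e E) z by rewrite {1}(edge_facets eE).
have TE z : face e (facets_of e E) z -> E z by rewrite {2}(edge_facets eE).
have fx := ET x Ex.
have d0 : d != 0 by apply: contraTneq dd => ->; rewrite lor0l ltxx.
have [|t [w [l [t0 wE fw ffw [xl wl]]]]] := compact_exit cP (face_future fx)
    (face_cone fx) (face_perp fx) pd (ltW dd) d0 _ dx.
  by move=> i xi; apply: pd; apply: contraTT isT => /xN; rewrite xi ltxx.
set v := normalize w in fw; have Ev := TE v fw.
have vl : lor v (e l) = 0 by rewrite /v /normalize lorZl wl mulr0.
clearbody v.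
exists l; last first.
  by move: wl; rewrite wE lorDl lorZl => h; rewrite -(pmulr_rgt0 _ t0); lra.
split; last by move=> /(_ x Ex)[_ h]; rewrite h ltxx in xl.
exists v; split=> //; last by split=> //; case: fw.
(* In the plane of [v] and [x], orthogonality to [e l] leaves only multiples of [v], so facet [l]
   cuts the edge in one point. *)
exists (l |: facets_of e E)%SET; apply/seteqP; split=> [q [pq hq]|_ ->]; last first.
  by split; [case: fw|move=> k /setU1P[->//|]; apply: (face_perp fw)].
have vx : v != x by apply: contraTneq xl => <-; rewrite vl ltxx.
have [|a [b qE]] := edge_span (d := q) eE Ev Ex vx.
  by move=> k kT; apply: hq; rewrite inE kT orbT.
have := hq l (setU11 _ _); rewrite {1}qE lorDl !lorZl vl mulr0 add0r => /eqP.
rewrite mulf_eq0 (lt_eqF xl) orbF => /eqP b0.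
have {}qE : q = a *: v by rewrite qE b0 scale0r addr0.
rewrite /= qE; apply: hyp_scale; first by case: fw => -[].
by rewrite -qE; case: pq.
Qed.

(** The edge is followed in the opposite directions [d] and [- d]; the opposite signs of the
    products with [d] show that the facets differ. *)
Lemma exists_framing_pair E : is_edge e E ->
  exists i j, [/\ i != j, framing e E i & framing e E j].
Proof.
move=> eE; have [x Ex xN] := edge_interior eE.
have ET z : E z -> face e (facets_of e E) z by rewrite {1}(edge_facets eE).
have [y Ey xy] : exists2 y, E y & x != y.
  have [y [z [Ey Ez yz]]] := edge_two_points eE.
  by have [xy|] := eqVneq x y; [exists z; rewrite // xy|exists y].
have [[hx _] px] := ET x Ex; have [[hy _] py] := ET y Ey.
have [xx _] := hx; have [yy _] := hy.
pose d := y + lor y x *: x.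
have pd : perp e (facets_of e E) d by apply: perpD => //; apply: perpZ.
have dx : lor d x = 0 by rewrite !lor_bilin xx; ring.
have dd : 0 < lor d d.
  have -> : lor d d = coshd x y ^+ 2 - 1.
    by rewrite /coshd /d !lor_bilin xx yy (lorC x y); ring.
  exact: (coshd_sqr_gt1 eE).
have [i fi di] := edge_endpoint eE Ex xN pd dd dx.
have [|||j fj dj] := @edge_endpoint E x (- d) eE Ex xN.
- by move=> k kT; rewrite lorNl pd // oppr0.
- by rewrite lorNl lorNr opprK.
- by rewrite lorNl dx oppr0.
exists i, j; split=> //; apply: contraTneq dj => <-.
by rewrite lorNl oppr_gt0 -leNgt ltW.
Qed.

Hypotheses (n_gt0 : (0 < n)%N) (ra : right_angled e).

Lemma right_angled_exists_edge : exists S, is_edge e (face e S).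
Proof.
have [v [S [[pv pS] nS sS]]] := exists_vertex.
have oS : orthogonal_on e S.
  by move=> i j iS jS ij; apply: (right_angled_orthogonal n_gt0 cP ra pv ij); apply: pS.
(* With [S] empty every vector would be a multiple of [v], impossible in dimension [n.+1 > 1]. *)
have [k kS] : exists k, k \in S.
  apply/set0Pn; apply/eqP => S0.
  have full : (1%:M <= v)%MS.
    apply/row_subP => r; have [|a ->] := sS (row r 1%:M); last exact: scalemx_sub.
    by move=> i; rewrite S0 inE.
  have := leq_trans (mxrankS full) (rank_leq_row v).
  by rewrite mxrank1 ltnS leqNgt n_gt0.
by exists (S :\ k)%SET; apply: (edge_of_vertex cP pv).
Qed.

(** At least one of the two facets contains [E], so they share a point of [E] and
    [right_angled_adjacent] applies. *)
Lemma right_angled_edge_ridge E : is_edge e E -> right_angled_ridge e E.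
Proof.
move=> eE i j ij ri rj nf.
have [x [_ [Ex _ _]]] := edge_two_points eE.
suff [v [vi vj]] : exists v, facet e i v /\ facet e j v.
  exact/ra/(right_angled_adjacent n_gt0 cP ra vi.1 ij vi.2 vj.2).
case: ri rj => [ci|fi] [cj|fj].
- by exists x; split; [apply: ci|apply: cj].
- by case: fj => [[v [_ Ev vj]] _]; exists v; split=> //; apply: ci.
- by case: fi => [[v [_ Ev vi]] _]; exists v; split=> //; apply: cj.
- by case: nf.
Qed.

(** Edges are faces of subsets of a finite index set, so the maximal distance is attained. *)
Lemma exists_outermost O : (exists S, is_edge e (face e S)) -> exists E, outermost e O E.
Proof.
move=> [S0 /asboolP eS0].
case: (@arg_maxP _ _ _ S0 (fun S => `[< is_edge e (face e S) >])
  (fun S => coshdist_pt O (face e S)) eS0) => S /asboolP eS Smax.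
exists (face e S); split=> // E' eE'; have [S' [ES' _]] := eE'.
by rewrite ES'; apply: Smax; apply/asboolP; rewrite -ES'.
Qed.

End Main.

Theorem theoremB (R : realType) (n : nat) (hn : (3 <= n)%N) :
  (forall (m : nat) (e : 'I_m -> 'rV[R]_(n.+1)) (O : 'rV[R]_(n.+1))
          (E : set 'rV[R]_(n.+1)),
     compact_polytope e -> coxeter e -> interior_point e O ->
     outermost e O E -> right_angled_ridge e E ->
     forall i j : 'I_m, i != j -> framing e E i -> framing e E j ->
       width e i j < n.+1%:R / n.-1%:R)
  /\
  (forall (m : nat) (e : 'I_m -> 'rV[R]_(n.+1)),
     compact_polytope e -> right_angled e ->
     exists E : set 'rV[R]_(n.+1), is_edge e E /\
       exists i j : 'I_m, [/\ i != j, framing e E i, framing e E j &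
                              width e i j < n.+1%:R / n.-1%:R]).
Proof.
have n1 : (1 < n)%N := ltnW hn.
split=> [m e O E cP _ iO oE rE i j|m e cP ra]; first exact: (outermost_width cP n1 iO oE rE).
have n0 := ltnW n1.
(* Any interior point can serve as [O] for the second claim. *)
have [x ix] := compact_interior cP.
have [E oE] := exists_outermost x (right_angled_exists_edge cP n0 ra).
have [eE _] := oE; exists E; split=> //.
have [i [j [ij fi fj]]] := exists_framing_pair cP eE.
exists i, j; split=> //; apply: (outermost_width cP n1 ix oE) => //.
exact: right_angled_edge_ridge.
Qed.
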